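(* Let $k$ be a field of arbitrary characteristic. For every integer $n\geq 1$, let $\operatorname{SL}_n\rtimes(\mathbb{Z}/2\mathbb{Z})$ be the semidirect product over $k$ in which the generator $\tau$ of $\mathbb{Z}/2\mathbb{Z}$ acts on $\operatorname{SL}_n$ by $A\mapsto (A^{-1})^T$. Then $B(\operatorname{SL}_n\rtimes (\mathbb{Z}/2\mathbb{Z}))$ is stably rational over $k$ for every $n\geq 1$.
   Context: $A^T$ denotes the transpose of $A$, and $\mathbb{Z}/2\mathbb{Z}$ is viewed as a constant finite group over $k$. Let $G$ be a smooth linear algebraic group over $k$, and let $\overline{k}$ be an algebraic closure of $k$. A finite-dimensional $k$-representation $G\to \operatorname{GL}(V)$ is generically free if the scheme-theoretic stabilizer $\operatorname{Stab}_G(v)$ is trivial for $v\in V(\overline{k})$ in general position. The Rosenlicht quotient $V/G$ is any reduced irreducible $k$-variety (well defined up to birational isomorphism over $k$) with function field $k(V/G)=k(V)^G$, the field of $G$-invariant rational functions on $V$ defined over $k$ (invariance is understood with respect to $G(\overline{k})$). A $d$-dimensional $k$-variety $X$ is stably rational over $k$ if $X\times \mathbb{A}^r$ is birationally equivalent over $k$ to $\mathbb{A}^{d+r}$ for some $r\ge 0$. By definition, ''$BG$ is stably rational over $k$'' means that $V/G$ is stably rational over $k$ for some generically free finite-dimensional $k$-representation $V$ of $G$; by the no-name lemma this is equivalent to $V/G$ being stably rational for every such $V$. No stacks are involved; this is only a shorthand. *)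

(* Defs.v *)
From HB Require Import structures.
From mathcomp Require Import all_boot all_order all_fingroup all_algebra.
From mathcomp Require Import generic_quotient.
From mathcomp Require Import mpoly ring.

Set Implicit Arguments.
Unset Strict Implicit.
Unset Printing Implicit Defensive.

Import GRing.Theory.
Local Open Scope ring_scope.
Local Open Scope quotient_scope.

(* Group schemes over k are handled through their functors of points on
   commutative k-algebras; by Yoneda a morphism of affine group schemes is a
   natural family of group homomorphisms.  A k-algebra is a commutative ring R
   with a structure morphism k -> R (instead of R : comAlgType k), so that a
   kbar-algebra becomes a k-algebra by mere composition.  The zero
   ring is left out (comNzRingType), which is harmless: an affine group scheme
   has exactly one point over it.                                              *)

Record kalg (k : fieldType) := KAlg {
  kalg_ring :> comNzRingType;
  kalg_str : {rmorphism k -> kalg_ring}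
}.

Definition restrict_scalars (k K : fieldType) (iota : {rmorphism k -> K})
  (R : kalg K) : kalg k := KAlg (@kalg_str K R \o iota).

Definition kalg_morphism (k : fieldType) (R S : kalg k)
  (f : {rmorphism R -> S}) : Prop :=
  forall c : k, f (kalg_str R c) = kalg_str S c.

Record group_functor (k : fieldType) := GroupFunctor {
  pts :> kalg k -> groupType;
  pts_map : forall R S : kalg k, {rmorphism R -> S} -> pts R -> pts S;
  pts_mapM : forall (R S : kalg k) (f : {rmorphism R -> S}),
    kalg_morphism f ->
    forall g h : pts R, pts_map f (g * h)%g = (pts_map f g * pts_map f h)%g;
  pts_map_id : forall (R : kalg k) (f : {rmorphism R -> R}),
    f =1 id -> forall g : pts R, pts_map f g = g;
  pts_map_comp : forall (R S T : kalg k) (f : {rmorphism R -> S})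
      (f' : {rmorphism S -> T}) (f'' : {rmorphism R -> T}),
    kalg_morphism f -> kalg_morphism f' -> f'' =1 f' \o f ->
    forall g : pts R, pts_map f'' g = pts_map f' (pts_map f g)
}.

(* Representations G -> GL(V) with V = k^m (column vectors); the values are
   invertible matrices because rho is multiplicative and sends 1 to 1.         *)
Record representation (k : fieldType) (G : group_functor k) (m : nat) :=
  Representation {
  rep_mx :> forall R : kalg k, G R -> 'M[R]_m;
  rep_mx1 : forall R : kalg k, rep_mx (1%g : G R) = 1%:M;
  rep_mxM : forall (R : kalg k) (g h : G R),
    rep_mx (g * h)%g = rep_mx g *m rep_mx h;
  rep_mx_nat : forall (R S : kalg k) (f : {rmorphism R -> S}),
    kalg_morphism f ->
    forall g : G R, rep_mx (pts_map f g) = map_mx f (rep_mx g)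
}.

Definition is_algebraic_closure (k : fieldType) (kbar : closedFieldType)
  (iota : {rmorphism k -> kbar}) : Prop :=
  forall x : kbar, algebraicOver iota x.

Definition kbar_alg (k : fieldType) (kbar : fieldType)
  (iota : {rmorphism k -> kbar}) : kalg k := KAlg iota.

(* Triviality of Stab_G(v) as a subgroup scheme of G_kbar: the stabilizer has
   no nontrivial points with values in any kbar-algebra R.                     *)
Definition stabilizer_trivial (k : fieldType) (kbar : closedFieldType)
  (iota : {rmorphism k -> kbar}) (G : group_functor k) (m : nat)
  (rho : representation G m) (v : 'cV[kbar]_m) : Prop :=
  forall (R : kalg kbar) (g : G (restrict_scalars iota R)),
    rho _ g *m map_mx (kalg_str R) v = map_mx (kalg_str R) v -> g = 1%g.

(* General position: on a nonempty principal open subset h != 0 of V(kbar);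
   these form a basis of the Zariski topology.                                 *)
Definition generically_free (k : fieldType) (kbar : closedFieldType)
  (iota : {rmorphism k -> kbar}) (G : group_functor k) (m : nat)
  (rho : representation G m) : Prop :=
  exists2 h : {mpoly kbar[m]}, h != 0 &
    forall v : 'cV[kbar]_m, h.@[fun i => v i 0] != 0 ->
      stabilizer_trivial iota rho v.

Definition ratfun (k : fieldType) (m : nat) : fieldType :=
  {fraction {mpoly k[m]}}.

Definition ratfunC (k : fieldType) (m : nat) (c : k) : ratfun k m :=
  tofrac (c%:MP_[m]).

(* The map of fraction fields induced by phi; meaningful only when phi is an
   injective ring morphism (the chosen fraction is then irrelevant).           *)
Definition frac_map (A B : idomainType) (phi : A -> B) (f : {fraction A}) :
  {fraction B} := tofrac (phi \n_(repr f)) / tofrac (phi \d_(repr f)).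

Definition lin_subst (K : fieldType) (m : nat) (A : 'M[K]_m)
  (p : {mpoly K[m]}) : {mpoly K[m]} :=
  p \mPo [tuple \sum_(j < m) A i j *: 'X_j | i < m].

(* f in k(V) is invariant when, seen in kbar(V), it satisfies f(g v) = f(v)
   for every g in G(kbar).                                                     *)
Definition invariant_ratfun (k : fieldType) (kbar : closedFieldType)
  (iota : {rmorphism k -> kbar}) (G : group_functor k) (m : nat)
  (rho : representation G m) (f : ratfun k m) : Prop :=
  let fbar := frac_map (map_mpoly iota) f in
  forall g : G (kbar_alg iota), frac_map (lin_subst (rho _ g)) fbar = fbar.

(* F, with structure map c : k -> F, is a function field of the Rosenlicht
   quotient V/G: a field over k isomorphic, through j, to k(V)^G.              *)
Definition rosenlicht_function_field (k : fieldType) (kbar : closedFieldType)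
  (iota : {rmorphism k -> kbar}) (G : group_functor k) (m : nat)
  (rho : representation G m) (F : fieldType) (c : {rmorphism k -> F}) : Prop :=
  exists2 j : {rmorphism F -> ratfun k m},
    forall a : k, j (c a) = ratfunC m a &
    forall f : ratfun k m,
      invariant_ratfun iota rho f <-> exists a : F, j a = f.

(* A k-variety X with function field (F, c) is stably rational: X x A^r and
   A^(d+r) have function fields F(y_1, ..., y_r) and k(z_1, ..., z_(d+r)), and
   birational equivalence over k is k-isomorphism of function fields.  Comparing
   transcendence degrees, d is necessarily the dimension of X.                 *)
Definition stably_rational (k F : fieldType) (c : {rmorphism k -> F}) : Prop :=
  exists d r : nat, exists2 psi : {rmorphism ratfun F r -> ratfun k (d + r)},
    bijective psi & forall a : k, psi (ratfunC r (c a)) = ratfunC (d + r) a.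

Definition BG_stably_rational (k : fieldType) (kbar : closedFieldType)
  (iota : {rmorphism k -> kbar}) (G : group_functor k) : Prop :=
  exists (m : nat) (rho : representation G m),
    generically_free iota rho /\
    exists (F : fieldType) (c : {rmorphism k -> F}),
      rosenlicht_function_field iota rho c /\ stably_rational c.

Section SpecialLinear.
Variables (R : comNzRingType) (n : nat).

Record SL := MkSL { SLmx :> 'M[R]_n; _ : \det SLmx == 1 }.
HB.instance Definition _ := [isSub for SLmx].
HB.instance Definition _ := [Choice of SL by <:].

Lemma det_SL (A : SL) : \det A = 1.
Proof. by case: A => A /= /eqP. Qed.

Fact SL_one_subproof : \det (1%:M : 'M[R]_n) == 1.
Proof. by rewrite det1. Qed.

Fact SL_mul_subproof (A B : SL) : \det (SLmx A *m SLmx B) == 1.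
Proof. by rewrite det_mulmx !det_SL mulr1. Qed.

Fact SL_adj_mul (A : SL) : \adj A *m A = 1%:M.
Proof. by rewrite mul_adj_mx det_SL. Qed.

Fact SL_inv_subproof (A : SL) : \det (\adj (SLmx A)) == 1.
Proof.
by have := congr1 determinant (SL_adj_mul A); rewrite det_mulmx det_SL mulr1 det1 => ->.
Qed.

Definition SL_one := MkSL SL_one_subproof.
Definition SL_mul A B := MkSL (SL_mul_subproof A B).
Definition SL_inv A := MkSL (SL_inv_subproof A).

Fact SL_mulA : associative SL_mul.
Proof. by move=> A B C; apply: val_inj; rewrite /= mulmxA. Qed.
Fact SL_mul1 : left_id SL_one SL_mul.
Proof. by move=> A; apply: val_inj; rewrite /= mul1mx. Qed.
Fact SL_mulr1 : right_id SL_one SL_mul.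
Proof. by move=> A; apply: val_inj; rewrite /= mulmx1. Qed.
Fact SL_mulV : left_inverse SL_one SL_inv SL_mul.
Proof. by move=> A; apply: val_inj; rewrite /= SL_adj_mul. Qed.
Fact SL_mulrV : right_inverse SL_one SL_inv SL_mul.
Proof. by move=> A; apply: val_inj; rewrite /= mul_mx_adj det_SL. Qed.

HB.instance Definition _ :=
  isGroup.Build SL SL_mulA SL_mul1 SL_mulr1 SL_mulV SL_mulrV.

Fact SL_trinv_subproof (A : SL) : \det (SLmx (A^-1)%g)^T == 1.
Proof. by rewrite det_tr det_SL. Qed.

Definition SL_trinv (A : SL) : SL := MkSL (SL_trinv_subproof A).

End SpecialLinear.

(* R-points of the constant group scheme Z/2Z: locally constant functions
   Spec R -> Z/2Z, i.e. idempotents e of R (e = 1 where the value is the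
   generator tau, e = 0 where it is neutral).  The law is addition mod 2.      *)
Section ConstantZ2.
Variable R : comNzRingType.

Record Z2 := MkZ2 { Z2val :> R; _ : Z2val * Z2val == Z2val }.
HB.instance Definition _ := [isSub for Z2val].
HB.instance Definition _ := [Choice of Z2 by <:].

Lemma Z2_idem (e : Z2) : Z2val e * Z2val e = Z2val e.
Proof. by case: e => e /= /eqP. Qed.

Fact Z2_one_subproof : 0 * 0 == 0 :> R.
Proof. by rewrite mulr0. Qed.

Fact Z2_mul_subproof (e f : Z2) (a := Z2val e) (b := Z2val f)
  (s := a + b - (a * b) *+ 2) : s * s == s.
Proof.
have ea : a * a = a by exact: Z2_idem.
have eb : b * b = b by exact: Z2_idem.
by apply/eqP; rewrite /s; ring: ea eb.
Qed.

Definition Z2_one := MkZ2 Z2_one_subproof.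
Definition Z2_mul (e f : Z2) := MkZ2 (Z2_mul_subproof e f).

Fact Z2_mulA : associative Z2_mul.
Proof. by move=> e f g; apply: val_inj => /=; ring. Qed.
Fact Z2_mul1 : left_id Z2_one Z2_mul.
Proof. by move=> e; apply: val_inj => /=; ring. Qed.
Fact Z2_mulr1 : right_id Z2_one Z2_mul.
Proof. by move=> e; apply: val_inj => /=; ring. Qed.
Fact Z2_mulV : left_inverse Z2_one id Z2_mul.
Proof.
by move=> e; apply: val_inj; rewrite /= Z2_idem mulr2n subrr.
Qed.

HB.instance Definition _ :=
  isGroup.Build Z2 Z2_mulA Z2_mul1 Z2_mulr1 Z2_mulV Z2_mulV.

Fact Z2_tau_subproof : 1 * 1 == 1 :> R.
Proof. by rewrite mulr1. Qed.
Definition Z2_tau := MkZ2 Z2_tau_subproof.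

End ConstantZ2.

(* The action of Z/2Z on SL_n with tau.A = (A^-1)^T: a section e of Z/2Z over
   Spec R acts as the identity on the open-closed subset e = 0 and as tau on its
   complement e = 1.                                                           *)
Section Twist.
Variables (R : comNzRingType) (n : nat).
Implicit Types (A B : SL R n) (e f : Z2 R).

Let mix (e : R) (X Y : 'M[R]_n) : 'M[R]_n := (1 - e) *: X + e *: Y.

Let mixM e (X Y X' Y' : 'M[R]_n) :
  mix (Z2val e) X Y *m mix (Z2val e) X' Y' =
  mix (Z2val e) (X *m X') (Y *m Y').
Proof.
have ee := Z2_idem e; set a := Z2val e in ee *.
have aa : (1 - a) * (1 - a) = 1 - a by ring: ee.
have a0 : (1 - a) * a = 0 by ring: ee.
have a0' : a * (1 - a) = 0 by ring: ee.
rewrite /mix mulmxDl !mulmxDr -!scalemxAl -!scalemxAr !scalerA.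
by rewrite aa ee a0 a0' !scale0r addr0 add0r.
Qed.

Fact twist_subproof e A :
  \det ((1 - Z2val e) *: SLmx A + Z2val e *: SLmx (SL_trinv A)) == 1.
Proof.
have det_mix (X Y : 'M[R]_n) :
    \det (mix (Z2val e) X Y) = (1 - Z2val e) * \det X + Z2val e * \det Y.
  have ee := Z2_idem e; set a := Z2val e in ee *.
  have prod_mix (u v : 'I_n -> R) :
      \prod_i ((1 - a) * u i + a * v i) =
      (1 - a) * (\prod_i u i) + a * (\prod_i v i).
    elim/big_rec3: _ => [|i x y z _ ->]; first by ring.
    by ring: ee.
  rewrite /determinant !mulr_sumr -big_split /=; apply: eq_bigr => s _.
  rewrite [in RHS]mulrCA [X in _ = _ + X]mulrCA -mulrDr -prod_mix.
  by congr (_ * _); apply: eq_bigr => i _; rewrite !mxE.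
rewrite [X in \det X]/(mix (Z2val e) A (SL_trinv A)) det_mix !det_SL.
by apply/eqP; ring.
Qed.

Definition twist e A : SL R n := MkSL (twist_subproof e A).

Lemma twistE e A :
  SLmx (twist e A) = (1 - Z2val e) *: SLmx A + Z2val e *: SLmx (SL_trinv A).
Proof. by []. Qed.

Fact twist1 A : twist 1%g A = A.
Proof. by apply: val_inj; rewrite /= subr0 scale1r scale0r addr0. Qed.

Lemma twist_tau A : twist (Z2_tau R) A = SL_trinv A.
Proof. by apply: val_inj; rewrite /= subrr scale0r scale1r add0r. Qed.

Fact twistM e A B : twist e (A * B)%g = (twist e A * twist e B)%g.
Proof.
apply: val_inj; rewrite /= -/(mix _ _ _) -/(mix _ _ _) -/(mix _ _ _) mixM.
by rewrite -[X in X^T]/(SLmx (A * B)^-1%g) invgM /= trmx_mul.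
Qed.

Fact SL_trinv_twist f A :
  SLmx (SL_trinv (twist f A)) = mix (Z2val f) (SL_trinv A) A.
Proof.
have tr_mix (e : R) (X Y : 'M[R]_n) : (mix e X Y)^T = mix e X^T Y^T.
  by rewrite linearD !linearZ.
apply: trmx_inj; rewrite tr_mix trmxK /= trmxK.
set X := mix _ _ _.
have XB : X *m SLmx (twist f A) = 1%:M.
  rewrite /= -/(mix _ _ _) mixM SL_adj_mul -trmx_mul SL_adj_mul trmx1.
  by rewrite /mix -scalerDl subrK scale1r.
have BV : SLmx (twist f A) *m \adj (SLmx (twist f A)) = 1%:M.
  by rewrite mul_mx_adj det_SL.
by rewrite -[RHS]mulmx1 -BV mulmxA XB mul1mx.
Qed.

Fact twist_comp e f A : twist (e * f)%g A = twist e (twist f A).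
Proof.
apply: val_inj; change (SLmx (twist (e * f)%g A) = SLmx (twist e (twist f A))).
rewrite !twistE SL_trinv_twist /mix.
have -> : Z2val (e * f)%g =
    Z2val e + Z2val f - (Z2val e * Z2val f) *+ 2 by [].
move: (SLmx A) (SLmx (SL_trinv A)) (Z2val e) (Z2val f) => X Y a b.
by apply/matrixP => i j; rewrite !mxE; ring.
Qed.

End Twist.

(* R-points of the semidirect product of SL_n by Z/2Z; the pair (A, e) stands
   for the product A * e.                                                      *)
Section SemiDirect.
Variables (R : comNzRingType) (n : nat).

Record SLZ2 := MkSLZ2 { SLZ2_SL : SL R n; SLZ2_Z2 : Z2 R }.

Definition SLZ2_pair (g : SLZ2) := (SLZ2_SL g, SLZ2_Z2 g).
Definition pair_SLZ2 (p : SL R n * Z2 R) := MkSLZ2 p.1 p.2.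
Fact SLZ2_pairK : cancel SLZ2_pair pair_SLZ2. Proof. by case. Qed.
HB.instance Definition _ := Choice.copy SLZ2 (can_type SLZ2_pairK).

Definition SLZ2_one := MkSLZ2 1%g 1%g.
Definition SLZ2_mul (g h : SLZ2) :=
  MkSLZ2 (SLZ2_SL g * twist (SLZ2_Z2 g) (SLZ2_SL h))%g
         (SLZ2_Z2 g * SLZ2_Z2 h)%g.
Definition SLZ2_inv (g : SLZ2) :=
  MkSLZ2 (twist (SLZ2_Z2 g)^-1 (SLZ2_SL g)^-1)%g (SLZ2_Z2 g)^-1%g.

Fact twist_one (e : Z2 R) : twist e (1%g : SL R n) = 1%g.
Proof. by apply: (@mulgI _ (twist e 1%g)); rewrite -twistM !mulg1. Qed.

Fact SLZ2_mulA : associative SLZ2_mul.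
Proof.
by move=> g h k; rewrite /SLZ2_mul /= twistM twist_comp !mulgA.
Qed.
Fact SLZ2_mul1 : left_id SLZ2_one SLZ2_mul.
Proof. by case=> A e; rewrite /SLZ2_mul /= twist1 !mul1g. Qed.
Fact SLZ2_mulr1 : right_id SLZ2_one SLZ2_mul.
Proof. by case=> A e; rewrite /SLZ2_mul /= twist_one !mulg1. Qed.
Fact SLZ2_mulV : left_inverse SLZ2_one SLZ2_inv SLZ2_mul.
Proof.
by case=> A e; rewrite /SLZ2_mul /SLZ2_inv /= -twistM !mulVg twist_one.
Qed.
Fact SLZ2_mulrV : right_inverse SLZ2_one SLZ2_inv SLZ2_mul.
Proof.
case=> A e; rewrite /SLZ2_mul /SLZ2_inv /= -twist_comp.
by rewrite mulgV twist1 mulgV.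
Qed.

HB.instance Definition _ :=
  isGroup.Build SLZ2 SLZ2_mulA SLZ2_mul1 SLZ2_mulr1 SLZ2_mulV SLZ2_mulrV.

End SemiDirect.

Section Functoriality.
Variables (n : nat) (R S : comNzRingType) (f : {rmorphism R -> S}).

Fact SL_map_subproof (A : SL R n) : \det (map_mx f A) == 1.
Proof. by rewrite det_map_mx det_SL rmorph1. Qed.
Definition SL_map (A : SL R n) : SL S n := MkSL (SL_map_subproof A).

Fact Z2_map_subproof (e : Z2 R) : f (Z2val e) * f (Z2val e) == f (Z2val e).
Proof. by rewrite -rmorphM Z2_idem. Qed.
Definition Z2_map (e : Z2 R) : Z2 S := MkZ2 (Z2_map_subproof e).

Definition SLZ2_map (g : SLZ2 R n) : SLZ2 S n :=
  MkSLZ2 (SL_map (SLZ2_SL g)) (Z2_map (SLZ2_Z2 g)).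

Fact SLZ2_mapM (g h : SLZ2 R n) :
  SLZ2_map (g * h)%g = (SLZ2_map g * SLZ2_map h)%g.
Proof.
case: g h => [A e] [B e']; congr MkSLZ2; apply: val_inj => /=; last first.
  by rewrite rmorphB rmorphD rmorphMn rmorphM.
rewrite map_mxM map_mxD !map_mxZ -map_trmx map_mx_adj.
by rewrite rmorphB rmorph1.
Qed.

End Functoriality.

Section SLnSemidirectZ2.
Variables (k : fieldType) (n : nat).

Let pts_SLZ2 (R : kalg k) : groupType := SLZ2 R n.

Fact SLZ2_map_id (R : kalg k) (f : {rmorphism R -> R}) :
  f =1 id -> forall g : pts_SLZ2 R, SLZ2_map f g = g.
Proof.
move=> f1 [A e]; congr MkSLZ2; apply: val_inj => /=; last exact: f1.
by apply/matrixP => i j; rewrite mxE f1.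
Qed.

Fact SLZ2_map_comp (R S T : kalg k) (f : {rmorphism R -> S})
    (f' : {rmorphism S -> T}) (f'' : {rmorphism R -> T}) :
  kalg_morphism f -> kalg_morphism f' -> f'' =1 f' \o f ->
  forall g : pts_SLZ2 R, SLZ2_map f'' g = SLZ2_map f' (SLZ2_map f g).
Proof.
move=> _ _ ff [A e]; congr MkSLZ2; apply: val_inj => /=; last exact: ff.
by apply/matrixP => i j; rewrite !mxE ff.
Qed.

Definition SL_semidirect_Z2 : group_functor k :=
  @GroupFunctor k (fun R => SLZ2 R n) (fun R S f => @SLZ2_map n R S f)
    (fun R S f _ => @SLZ2_mapM n R S f) SLZ2_map_id SLZ2_map_comp.

End SLnSemidirectZ2.

(* Main.v *)
From HB Require Import structures.
Require Import Defs.
From mathcomp Require Import all_boot all_order all_fingroup all_algebra.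
From mathcomp Require Import generic_quotient mpoly ring.

Set Implicit Arguments.
Unset Strict Implicit.
Unset Printing Implicit Defensive.

Import GRing.Theory.
Local Open Scope ring_scope.

(** Let [G] be the semidirect product.  Take for [V] the space of pairs [(X, Y)]
    of [n x n] matrices, on which [A] in SL_n acts by [(A X, A^-T Y)] and [tau]
    exchanges [X] and [Y]: this is [n] copies of the sum of the standard
    representation and its dual.  The stabilizer of [(X, Y)] is trivial as soon
    as [det X <> 0] and [det X <> det Y] ([pairs_generically_free]).  It turns out
    that [k(V)^G] is purely transcendental over [k], of degree [n^2 + 1], in
    every characteristic.

    Put [d = det X], [d' = det Y] and [M = X^T Y].  These are SL_n-invariants
    with the single relation [det M = d d'], and [tau] acts on them by
    exchanging [d] and [d'] and transposing [M].  The relation is linear in the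
    corner entry [M 0 0], whose coefficient is the complementary minor; so
    [M 0 0] can be dropped, and the remaining [n^2 + 1] quantities are
    independent coordinates, merely permuted by [tau].  Their [tau]-invariant
    combinations [d + d'], [d d'] and the entries of [d M + d' M^T] other than
    the corner one are again [n^2 + 1] in number, and give back all of them
    once the roots [d], [d'] of [T^2 - (d + d') T + d d'] are adjoined.

    Independence ([pull_inj]) is checked on points: over an algebraically closed
    field, both steps from [(X, Y)] to [(M, d)] without corner and from there
    to the [tau]-invariant combinations hit every point of a nonempty open set
    ([sl_invariants_surj], [swap_invariants_surj]).

    It remains to see that every invariant rational function [f = a / b] is a
    function of these generators ([invariant_in_image]).  One would like to
    evaluate [f] at a point of the orbit of [(X, Y)] that depends on [(M, d)]
    only, but [b] might vanish at the chosen point.  So the point is made to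
    depend on an auxiliary matrix [B]; as [b] does not vanish at [B = X], a [B]
    with entries in the (infinite) field [F] of the generators can be found at
    which it does not vanish either ([section_avoids_poles]).  The point is rational
    in [B], [M] and [d], and the entries of [M] lie in [F(d)] ([conj_rel_entries]);
    so [f v = u] with [u], [v] in [F(d)] and [v <> 0].  The conjugates [u'], [v']
    of [u], [v] under [d |-> d'] are obtained by exchanging [X] and [Y], and
    [tau]-invariance yields [f v' = u'] too; therefore [f] lies in [F]
    ([conj_rel_descent]).  *)

(** * Evaluation of polynomials *)

Lemma rmorph_mmap l (R S T : comNzRingType) (g : {rmorphism S -> T}) (f : {rmorphism R -> S}) h
    (p : {mpoly R[l]}) :
  g (mmap f h p) = mmap (g \o f) (g \o h) p.
Proof.
rewrite /mmap rmorph_sum; apply: eq_bigr => a _; rewrite rmorphM rmorph_prod.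
by congr (_ * _); apply: eq_bigr => i _; rewrite rmorphXn.
Qed.

Lemma mmapXU l (R S : comNzRingType) (f : {rmorphism R -> S}) h i :
  mmap f h ('X_i : {mpoly R[l]}) = h i.
Proof. by rewrite mmapX mmap1U. Qed.

Lemma eq_mmap l (R S : comNzRingType) (f f' : {rmorphism R -> S}) h h' (p : {mpoly R[l]}) :
  f =1 f' -> h =1 h' -> mmap f h p = mmap f' h' p.
Proof.
move=> ef eh; apply: eq_bigr => a _; rewrite ef; congr (_ * _).
exact: mmap1_eq.
Qed.

Lemma eq_mmapr l (R S : comNzRingType) (f : {rmorphism R -> S}) h h' (p : {mpoly R[l]}) :
  h =1 h' -> mmap f h p = mmap f h' p.
Proof. by move=> e; apply: (@eq_mmap _ _ _ f f). Qed.

Lemma mmap_map_mpoly l (R S T : comNzRingType) (f : {rmorphism R -> S}) (g : {rmorphism S -> T}) h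
    (p : {mpoly R[l]}) :
  mmap g h (map_mpoly f p) = mmap (g \o f) h p.
Proof.
rewrite [LHS](rmorph_mmap (mmap g h) (@mpolyC l S \o f)).
apply: (@eq_mmap _ _ _ (mmap g h \o (@mpolyC l S \o f)) (g \o f)) => i /=.
  exact: mmapC.
exact: mmapXU.
Qed.

Lemma mmap_comp l l' (R S : comNzRingType) (f : {rmorphism R -> S}) h
    (q : l'.-tuple {mpoly R[l]}) p :
  mmap f h (p \mPo q) = mmap f (fun i => mmap f h (tnth q i)) p.
Proof.
rewrite [LHS](rmorph_mmap (mmap f h) (@mpolyC l R)).
apply: (@eq_mmap _ _ _ (mmap f h \o @mpolyC l R)) => i //=.
exact: mmapC.
Qed.

Definition infinite_in (T : eqType) (P : T -> Prop) :=
  forall s : seq T, exists2 x, P x & x \notin s.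

Lemma poly_nonroot (R : idomainType) (P : R -> Prop) (p : {poly R}) :
  infinite_in P -> p != 0 -> exists2 x, P x & p.[x] != 0.
Proof.
move=> infP p0.
(* [P] has more elements than [p] can have roots *)
have pick m : exists2 s : seq R, uniq s & size s = m /\ forall x, x \in s -> P x.
  elim: m => [|m [s us [<- Ps]]]; first by exists [::].
  have [x Px xs] := infP s; exists (x :: s); rewrite /= ?xs //; split=> // y.
  by rewrite inE => /orP[/eqP->|/Ps].
have [s us [ss Ps]] := pick (size p).
have /allPn[x xs px] : ~~ all (root p) s.
  by apply/negP => rs; have := max_poly_roots p0 rs us; rewrite ss ltnn.
by exists x; [exact: Ps | ].
Qed.

Section LastVariable.
Variables (l : nat) (R : comNzRingType).

(** A version of the isomorphism of [R[X_0, ..., X_l]] with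
    [R[X_0, ..., X_(l-1)][X_l]] that is an evaluation morphism, so that both its
    injectivity and its effect on points follow from [last_var_eval]. *)
Definition last_var (p : {mpoly R[l.+1]}) : {poly {mpoly R[l]}} :=
  mmap (polyC \o @mpolyC l R)
    (fun i => if unlift ord_max i is Some j then ('X_j)%:P else 'X) p.

Lemma last_var_eval (S : comNzRingType) (g : {rmorphism {mpoly R[l]} -> S}) t p :
  (map_poly g (last_var p)).[t] =
  mmap (g \o @mpolyC l R)
    (fun i => if unlift ord_max i is Some j then g 'X_j else t) p.
Proof.
rewrite -[LHS]/((horner_eval t \o map_poly g) _) /last_var.
rewrite (rmorph_mmap (horner_eval t \o map_poly g) (polyC \o @mpolyC l R)).
apply: (@eq_mmap _ _ _ ((horner_eval t \o map_poly g) \o (polyC \o @mpolyC l R))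
  (g \o @mpolyC l R)) => i /=; rewrite /horner_eval.
  by rewrite map_polyC hornerC.
by case: unliftP => [j _|_]; rewrite ?map_polyC ?map_polyX ?hornerC ?hornerX.
Qed.

Lemma last_var_eq0 p : last_var p = 0 -> p = 0.
Proof.
pose g : {mpoly R[l]} -> {mpoly R[l.+1]} := mmap (@mpolyC l.+1 R) (fun j => 'X_(lift ord_max j)).
move=> p0; have := last_var_eval g 'X_ord_max p; rewrite p0 rmorph0 horner0.
move=> ->; rewrite -[LHS]comp_mpoly_id.
apply: (@eq_mmap _ _ _ (@mpolyC _ R) (g \o @mpolyC l R)) => [a|i] /=.
  by rewrite /g mmapC.
rewrite tnth_mktuple; case: unliftP => [j ->|->] //; by rewrite /g mmapXU.
Qed.
End LastVariable.

(** The coordinates can be taken in any infinite subset: this is used for an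
    algebraically closed field and for a subfield of a rational function field. *)
Lemma mpoly_nonroot (R : idomainType) (P : R -> Prop) l (p : {mpoly R[l]}) :
  infinite_in P -> p != 0 ->
  exists2 x : 'I_l -> R, (forall i, P (x i)) & p.@[x] != 0.
Proof.
move=> infP; elim: l p => [|l IH] p p0.
  exists (fun _ => 0); first by case.
  by rewrite (nvar0_mpolyC p) mevalC; apply: contraNneq p0 => p0; rewrite (nvar0_mpolyC p) p0.
have q0 : last_var p != 0 by apply: contraNneq p0 => /last_var_eq0 ->.
have [y Py cy] := IH (lead_coef (last_var p)) (etrans (congr1 negb (lead_coef_eq0 _)) q0).
have my0 : map_poly (meval y) (last_var p) != 0.
  apply: contraNneq cy => my; rewrite /lead_coef -coef_map /=.
  by have /= -> := my; rewrite coef0.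
have [t Pt pt] := poly_nonroot infP my0.
exists (fun i => if unlift ord_max i is Some j then y j else t).
  by move=> i; case: unliftP.
move: pt; rewrite last_var_eval; congr (_ != 0).
apply: (@eq_mmap _ _ _ (meval y \o @mpolyC l R) idfun) => [a|i] /=.
  by rewrite mevalC.
by case: unliftP => // j _; rewrite mevalXU.
Qed.

Lemma closed_infinite (K : closedFieldType) : infinite_in (fun _ : K => True).
Proof.
move=> s; have : \prod_(a <- s) ('X - a%:P) != 0 :> {poly K}.
  exact/monic_neq0/monic_prod_XsubC.
case/closed_nonrootP => x; rewrite root_prod_XsubC => xs.
by exists x.
Qed.

(** Polynomials over [k], which may be finite, are tested on points of an
    algebraically closed extension: an identity checked on the points of a
    nonempty open set [h <> 0] holds formally, hence at points with values in
    any [k]-algebra. *)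
Lemma mpoly_eq0_closed (k : fieldType) (K : closedFieldType)
    (iota : {rmorphism k -> K}) l (p h : {mpoly k[l]}) : h != 0 ->
  (forall x, mmap iota x h != 0 -> mmap iota x p = 0) -> p = 0.
Proof.
move=> h0 ph; apply/eqP/negPn/negP => p0.
have q0 : map_mpoly iota (p * h) != 0.
  have : p * h != 0 by rewrite mulf_neq0.
  apply: contraNneq => q0; apply/eqP/mpolyP => a.
  by apply: (fmorph_inj iota); rewrite -mcoeff_map_mpoly q0 !mcoeff0 rmorph0.
have [x _] := mpoly_nonroot (@closed_infinite K) q0.
rewrite /meval (mmap_map_mpoly iota idfun) rmorphM; case/negP; apply/eqP.
change (mmap iota x p * mmap iota x h = 0).
have [->|/ph ->] := eqVneq (mmap iota x h) 0; by rewrite ?mulr0 ?mul0r.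
Qed.

(** * Fraction fields *)

Lemma frac_numden (R : idomainType) (x : {fraction R}) :
  x = tofrac \n_(repr x) / tofrac \d_(repr x).
Proof.
have b0 := denom_ratioP (repr x).
apply: (@mulIf _ (tofrac (\d_(repr x)))); rewrite ?tofrac_eq0 //.
rewrite divfK ?tofrac_eq0 // -{1}[x]reprK.
rewrite /tofrac; unlock tofrac; rewrite -[LHS]FracField.pi_mul.
apply/eqmodP; rewrite /= FracField.equivfE /FracField.mulf.
by rewrite !numden_Ratio ?mulr1 ?oner_neq0 // mulrC.
Qed.

Section FracMap.
Variables (A B : idomainType) (phi : {rmorphism A -> B}).
Hypothesis phi_inj : injective phi.

Let phi_eq0 x : (phi x == 0) = (x == 0).
Proof. by rewrite -(rmorph0 phi) (inj_eq phi_inj). Qed.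

Lemma frac_map_div a b : b != 0 ->
  frac_map phi (tofrac a / tofrac b) = tofrac (phi a) / tofrac (phi b).
Proof.
move=> b0; rewrite /frac_map; set x := tofrac a / _.
have c0 := denom_ratioP (repr x); have := frac_numden x.
rewrite {1}/x => /eqP; rewrite eqr_div ?tofrac_eq0 // -!tofracM tofrac_eq => /eqP e.
apply/eqP; rewrite eqr_div ?tofrac_eq0 ?phi_eq0 // -!tofracM tofrac_eq -!rmorphM.
by rewrite e.
Qed.

Lemma frac_map_tofrac a : frac_map phi (tofrac a) = tofrac (phi a).
Proof.
by rewrite -[tofrac a]divr1 -tofrac1 frac_map_div ?oner_neq0 // rmorph1 tofrac1 divr1.
Qed.

Lemma frac_map_is_zmod_morphism : zmod_morphism (frac_map phi).
Proof.
move=> x y; rewrite (frac_numden x) (frac_numden y).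
set a := \n_(_); set b := \d_(_); set c := \n_(_); set d := \d_(_).
have b0 : b != 0 by exact: denom_ratioP.
have d0 : d != 0 by exact: denom_ratioP.
have fneq0 (R : idomainType) (u : R) : u != 0 -> tofrac u != 0 by rewrite tofrac_eq0.
have -> : tofrac a / tofrac b - tofrac c / tofrac d = tofrac (a * d - c * b) / tofrac (b * d).
  by rewrite -mulNr addf_div ?fneq0 // tofracB !tofracM mulNr.
rewrite !frac_map_div ?mulf_neq0 // -[in RHS]mulNr addf_div ?fneq0 ?phi_eq0 //.
by rewrite rmorphB !rmorphM tofracB !tofracM mulNr.
Qed.

Lemma frac_map_is_monoid_morphism : monoid_morphism (frac_map phi).
Proof.
split=> [|x y]; first by rewrite -{1}tofrac1 frac_map_tofrac rmorph1 tofrac1.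
rewrite (frac_numden x) (frac_numden y).
set a := \n_(_); set b := \d_(_); set c := \n_(_); set d := \d_(_).
have b0 : b != 0 by exact: denom_ratioP.
have d0 : d != 0 by exact: denom_ratioP.
by rewrite mulf_div -!tofracM !frac_map_div ?mulf_neq0 // mulf_div -!tofracM !rmorphM.
Qed.

(** The packaging needs the injectivity hypothesis, so the morphism structure
    is delivered as an existence statement. *)
Lemma frac_map_rmorphism :
  {g : {rmorphism {fraction A} -> {fraction B}} | g =1 frac_map phi}.
Proof.
pose Z := GRing.isZmodMorphism.Build _ _ _ frac_map_is_zmod_morphism.
pose M := GRing.isMonoidMorphism.Build _ _ _ frac_map_is_monoid_morphism.
pose g : {rmorphism {fraction A} -> {fraction B}} := HB.pack (frac_map phi) Z M.
by exists g.
Qed.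
End FracMap.

Section ConstantField.
Variables (k : fieldType) (l : nat).
HB.instance Definition _ :=
  GRing.RMorphism.copy (@ratfunC k l) (@tofrac {mpoly k[l]} \o @mpolyC l k).
End ConstantField.

Lemma ratfun0_isom (F : fieldType) :
  exists2 g : {rmorphism ratfun F 0 -> F}, bijective g & cancel (@ratfunC F 0) g.
Proof.
pose inv (x : ratfun F 0) : F :=
  (\n_(repr x))@_0%MM / (\d_(repr x))@_0%MM.
have inK : cancel inv (@ratfunC F 0).
  move=> x; rewrite {2}(frac_numden x) (nvar0_mpolyC \n_(repr x)) (nvar0_mpolyC \d_(repr x)).
  by rewrite /inv fmorph_div.
have CK : cancel (@ratfunC F 0) inv.
  by move=> x; apply: (fmorph_inj (@ratfunC F 0)); exact: inK.
pose Z := GRing.isZmodMorphism.Build _ _ inv (can2_zmod_morphism CK inK).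
pose M := GRing.isMonoidMorphism.Build _ _ inv (can2_monoid_morphism CK inK).
pose g : {rmorphism ratfun F 0 -> F} := HB.pack inv Z M.
by exists g => //; exists (@ratfunC F 0).
Qed.

(** A purely transcendental extension is stably rational with no extra
    variable: rational functions in zero variables over [F] are just [F]. *)
Lemma ratfun_stably_rational (k : fieldType) N : stably_rational (@ratfunC k N).
Proof.
have [g bg gC] := ratfun0_isom (ratfun k N).
have isom N' : N = N' -> exists2 psi : {rmorphism ratfun (ratfun k N) 0 -> ratfun k N'},
    bijective psi & forall a, psi (ratfunC 0 (ratfunC N a)) = ratfunC N' a.
  by move=> <-; exists g.
by exists N, 0%N; apply: isom; rewrite addn0.
Qed.

(** * The representation *)

Section DoubledMatrix.
Variables (R : comNzRingType) (n : nat).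
Implicit Types g h : SLZ2 R n.

(** The action of [(A, e)] on the sum of the standard representation and its
    dual: it is [A] and [A^-T] on the diagonal where [e = 0], on the
    antidiagonal where [e = 1]. *)
Definition double_mx g : 'M[R]_(n + n) :=
  let A := SLmx (SLZ2_SL g) in let A' := SLmx (SL_trinv (SLZ2_SL g)) in
  let e := Z2val (SLZ2_Z2 g) in
  block_mx ((1 - e) *: A) (e *: A) (e *: A') ((1 - e) *: A').

Lemma double_mx1 : double_mx 1%g = 1%:M.
Proof.
have tr1 : SLmx (SL_trinv (1%g : SL R n)) = 1%:M.
  by rewrite -trmx1; congr trmx; rewrite -[LHS]mulmx1; apply: (@SL_adj_mul R n 1%g).
rewrite /double_mx tr1 [Z2val _]/= !scale0r subr0 !scale1r.
by rewrite -scalar_mx_block.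
Qed.

Lemma double_mxM g h : double_mx (g * h)%g = double_mx g *m double_mx h.
Proof.
case: g h => [A e] [B f]; rewrite /double_mx [SLZ2_SL _]/= [SLZ2_Z2 _]/=.
have -> : SLmx (SL_trinv (A * twist e B)%g) =
    SLmx (SL_trinv A) *m ((1 - Z2val e) *: SLmx (SL_trinv B) + Z2val e *: SLmx B).
  rewrite -SL_trinv_twist /=.
  by rewrite -trmx_mul -[X in X^T]/(SLmx (A * twist e B)^-1%g) invgM.
rewrite mulmx_block.
have -> : SLmx (A * twist e B)%g =
    SLmx A *m ((1 - Z2val e) *: SLmx B + Z2val e *: SLmx (SL_trinv B)) by [].
have -> : Z2val (e * f)%g =
    Z2val e + Z2val f - (Z2val e * Z2val f) *+ 2 by [].
have ee := Z2_idem e; move: ee.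
move: (SLmx A) (SLmx (SL_trinv A)) (SLmx B) (SLmx (SL_trinv B)) => X X' Y Y'.
move: (Z2val e) (Z2val f) => a b ee.
rewrite !mulmxDr -!scalemxAl -!scalemxAr !scalerDr !scalerA.
by congr block_mx; [ | | rewrite addrC | rewrite addrC]; congr (_ *: _ + _ *: _); ring: ee.
Qed.
End DoubledMatrix.

Lemma map_double_mx (R S : comNzRingType) n (f : {rmorphism R -> S}) (g : SLZ2 R n) :
  double_mx (SLZ2_map f g) = map_mx f (double_mx g).
Proof.
rewrite map_block_mx !map_mxZ rmorphB rmorph1 /double_mx /=.
by rewrite -map_trmx map_mx_adj.
Qed.

Section Copies.
Variables (R : comNzRingType) (p q : nat).

(** Points of affine space are functions on the coordinate indices; this one
    reads a point of [V] as a matrix, whose columns are the [q] copies. *)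
Definition pt_mx (x : 'I_(p * q) -> R) : 'M[R]_(p, q) := vec_mx (\row_i x i).
Definition copies_mx (B : 'M[R]_p) : 'M[R]_(p * q) := (lin_mulmx B)^T.
Definition lin_pt l (B : 'M[R]_l) (x : 'I_l -> R) i := \sum_j B i j * x j.

Lemma pt_mx_lin (B : 'M[R]_p) x : pt_mx (lin_pt (copies_mx B) x) = B *m pt_mx x.
Proof.
rewrite -[RHS]mxvecK; congr vec_mx; rewrite -(mul_vec_lin (mulmx B)).
rewrite /pt_mx vec_mxK; apply/rowP => i; rewrite !mxE.
by apply: eq_bigr => j _; rewrite !mxE mulrC.
Qed.

Lemma pt_mxK (V : 'M[R]_(p, q)) : pt_mx (fun i => mxvec V 0 i) = V.
Proof. by rewrite -[RHS]mxvecK; congr vec_mx; apply/rowP => i; rewrite mxE. Qed.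

Lemma eq_pt_mx x x' : x =1 x' -> pt_mx x = pt_mx x'.
Proof. by move=> ex; congr vec_mx; apply/rowP => i; rewrite !mxE. Qed.

Lemma lin_ptE l (B : 'M[R]_l) x i : lin_pt B x i = (B *m (\col_j x j)) i 0.
Proof. by rewrite mxE; apply: eq_bigr => j _; rewrite mxE. Qed.

Lemma lin_pt1 l (x : 'I_l -> R) : lin_pt 1%:M x =1 x.
Proof. by move=> i; rewrite lin_ptE mul1mx mxE. Qed.

Lemma lin_ptM l (A B : 'M[R]_l) x : lin_pt A (lin_pt B x) =1 lin_pt (A *m B) x.
Proof.
move=> i; rewrite !lin_ptE -mulmxA; congr ((_ *m _) i 0).
by apply/colP => j; rewrite mxE lin_ptE.
Qed.

Lemma copies_mx1 : copies_mx 1%:M = 1%:M.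
Proof.
apply/trmx_inj; rewrite trmxK trmx1; apply/row_matrixP => i.
by rewrite !rowE mulmx1 -[delta_mx _ _]vec_mxK mul_vec_lin /= mul1mx.
Qed.

Lemma copies_mxM B C : copies_mx (B *m C) = copies_mx B *m copies_mx C.
Proof.
apply/trmx_inj; rewrite trmx_mul !trmxK; apply/row_matrixP => i.
by rewrite !rowE mulmxA -[delta_mx _ _]vec_mxK !mul_vec_lin /= mulmxA.
Qed.
End Copies.

Lemma map_pt_mx (R S : comNzRingType) (f : {rmorphism R -> S}) p q (x : 'I_(p * q) -> R) :
  map_mx f (pt_mx x) = pt_mx (f \o x).
Proof. by rewrite map_vec_mx; congr vec_mx; apply/rowP => i; rewrite !mxE. Qed.

Lemma map_copies_mx (R S : comNzRingType) (f : {rmorphism R -> S}) p q (B : 'M[R]_p) :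
  map_mx f (copies_mx q B) = copies_mx q (map_mx f B).
Proof.
rewrite /copies_mx -map_trmx; congr trmx; apply: map_lin_mx => A.
exact: map_mxM.
Qed.

Section Rep.
Variables (k : fieldType) (n : nat).

Fact pairs_rep1 (R : kalg k) :
  copies_mx n (double_mx (1%g : SL_semidirect_Z2 k n R)) = 1%:M.
Proof. by rewrite double_mx1 copies_mx1. Qed.

Fact pairs_repM (R : kalg k) (g h : SL_semidirect_Z2 k n R) :
  copies_mx n (double_mx (g * h)%g) = copies_mx n (double_mx g) *m copies_mx n (double_mx h).
Proof. by rewrite double_mxM copies_mxM. Qed.

Fact pairs_rep_nat (R S : kalg k) (f : {rmorphism R -> S}) :
  kalg_morphism f -> forall g : SL_semidirect_Z2 k n R,
  copies_mx n (double_mx (pts_map f g)) = map_mx f (copies_mx n (double_mx g)).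
Proof. by move=> _ g; rewrite map_copies_mx -map_double_mx. Qed.

Definition pairs_rep : representation (SL_semidirect_Z2 k n) ((n + n) * n) :=
  Representation pairs_rep1 pairs_repM pairs_rep_nat.
End Rep.

(** * The generators of the field of invariants *)

Section Coordinates.
Variable n' : nat.
Notation n := n'.+1.
Notation m := ((n + n) * n)%N.
Notation N := (n * n + 1)%N.

Section Ring.
Variable R : comNzRingType.
Implicit Types (W M : 'M[R]_n) (c : R) (x : 'I_m -> R) (y z : 'I_N -> R).

(** The shape of both coordinate systems used on the space of invariants: a
    square matrix, whose corner entry is reused for a quantity unrelated to the
    other entries, and a scalar. *)
Definition corner_pt W c (i : 'I_N) : R := row_mx (mxvec W) (c%:M : 'M_1) 0 i.
Definition pt_matrix y : 'M[R]_n := vec_mx (lsubmx (\row_i y i)).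
Definition pt_scalar y : R := y (rshift (n * n) ord0).

Lemma corner_ptK y : corner_pt (pt_matrix y) (pt_scalar y) =1 y.
Proof.
move=> i; have <- : (\row_i y i) 0 i = y i by rewrite mxE.
rewrite /corner_pt vec_mxK -[in RHS](hsubmxK (\row_i y i)).
congr (row_mx _ _ _ _); apply/matrixP => a b; rewrite !mxE !ord1 eqxx mulr1n.
by congr y.
Qed.

Lemma pt_matrixK W c : pt_matrix (corner_pt W c) = W.
Proof.
rewrite /pt_matrix; set r := \row_i _.
have -> : r = row_mx (mxvec W) c%:M by apply/rowP => i; rewrite mxE.
by rewrite row_mxKl mxvecK.
Qed.

Lemma pt_scalarK W c : pt_scalar (corner_pt W c) = c.
Proof. by rewrite /pt_scalar /corner_pt row_mxEr mxE eqxx mulr1n. Qed.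

Definition patch W c : 'M[R]_n :=
  \matrix_(i, j) if (i == 0) && (j == 0) then c else W i j.

Lemma patch_patch W c c' : patch (patch W c) c' = patch W c'.
Proof. by apply/matrixP => i j; rewrite !mxE; case: (_ && _). Qed.

Lemma patch_id W : patch W (W 0 0) = W.
Proof. by apply/matrixP => i j; rewrite !mxE; case: ifP => // /andP[/eqP-> /eqP->]. Qed.

Lemma tr_patch W c : (patch W c)^T = patch W^T c.
Proof. by apply/matrixP => i j; rewrite !mxE andbC. Qed.

Definition minor00 W := \det (row' 0 (col' 0 W)).

Lemma minor00_patch W c : minor00 (patch W c) = minor00 W.
Proof. by congr (\det _); apply/matrixP => i j; rewrite !mxE. Qed.

Lemma minor00_tr W : minor00 W^T = minor00 W.
Proof. by rewrite /minor00 -[LHS]det_tr; congr (\det _); apply/matrixP => i j; rewrite !mxE. Qed.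

(** The corner entry occurs linearly in the determinant, so the relation
    [det M = d d'] determines [M 0 0]. *)
Lemma det_patch W c : \det (patch W c) = c * minor00 W + \det (patch W 0).
Proof.
rewrite !(expand_det_row _ 0) !big_ord_recl !mxE eqxx /= mul0r add0r; congr (_ + _).
  by rewrite /cofactor expr0 mul1r -/(minor00 _) minor00_patch.
apply: eq_bigr => j _; rewrite !mxE /=; congr (_ * (_ * \det _)).
by apply/matrixP => a b; rewrite !mxE.
Qed.

Definition first_mx c : 'M[R]_n := diag_mx (\row_i if i == 0 then c else 1).

Lemma det_first_mx c : \det (first_mx c) = c.
Proof.
by rewrite det_diag big_ord_recl big1 ?mxE ?mulr1 // => i _; rewrite mxE.
Qed.

Lemma tr_first_mx c : (first_mx c)^T = first_mx c.
Proof. exact: tr_diag_mx. Qed.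

Lemma first_mxM c c' : first_mx c *m first_mx c' = first_mx (c * c').
Proof.
rewrite mulmx_diag; congr diag_mx; apply/rowP => i; rewrite !mxE.
by case: eqP => // _; rewrite mulr1.
Qed.

Lemma first_mx1 : first_mx 1 = 1%:M.
Proof.
by rewrite -diag_const_mx; congr diag_mx; apply/rowP => i; rewrite !mxE if_same.
Qed.

Definition vecs x := usubmx (pt_mx x).
Definition covecs x := dsubmx (pt_mx x).
Definition pairing x := (vecs x)^T *m covecs x.

(** The invariants [(M, d)] of SL_n, with the corner entry of [M], which
    [det M = d d'] determines from the rest, replaced by [d']. *)
Definition sl_invariants x : 'I_N -> R :=
  corner_pt (patch (pairing x) (\det (covecs x))) (\det (vecs x)).

Definition conj_sum (W : 'M[R]_n) (d d' : R) := d *: W + d' *: W^T.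

(** Invariants of the involution that exchanges [d] and [d'] and transposes [W].
    The combination [d W + d' W^T] works in every characteristic: on a pair of
    exchanged entries its matrix [[d, d'], [d', d]] has determinant
    [d^2 - d'^2], which is not identically zero even in characteristic 2. *)
Definition swap_invariants y : 'I_N -> R :=
  let W := pt_matrix y in let d := pt_scalar y in let d' := W 0 0 in
  corner_pt (patch (conj_sum W d d') (d + d')) (d * d').

Lemma patch00 W c : patch W c 0 0 = c.
Proof. by rewrite mxE. Qed.

Lemma patchE W c i j : (i == 0) && (j == 0) = false -> patch W c i j = W i j.
Proof. by rewrite mxE => ->. Qed.

Lemma conj_sumE W d d' i j : conj_sum W d d' i j = d * W i j + d' * W j i.
Proof. by rewrite /conj_sum !mxE. Qed.

Lemma patch_conj_sum W (c d d' c' : R) :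
  patch (conj_sum (patch W c) d d') c' = patch (conj_sum W d d') c'.
Proof.
apply/matrixP => i j; rewrite !mxE [(j == 0) && _]andbC.
by case: (_ && _).
Qed.

Lemma det_pairing x : \det (pairing x) = \det (vecs x) * \det (covecs x).
Proof. by rewrite det_mulmx det_tr. Qed.

End Ring.

Lemma map_corner_pt (R S : comNzRingType) (f : {rmorphism R -> S}) W c i :
  f (corner_pt W c i) = corner_pt (map_mx f W) (f c) i.
Proof. by rewrite /corner_pt -map_mxvec -map_scalar_mx -map_row_mx [RHS]mxE. Qed.

Lemma map_patch (R S : comNzRingType) (f : {rmorphism R -> S}) W c :
  map_mx f (patch W c) = patch (map_mx f W) (f c).
Proof. by apply/matrixP => i j; rewrite !mxE; case: (_ && _). Qed.

Lemma map_sl_invariants (R S : comNzRingType) (f : {rmorphism R -> S}) x i :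
  f (sl_invariants x i) = sl_invariants (f \o x) i.
Proof.
by rewrite map_corner_pt map_patch map_mxM -map_trmx -!det_map_mx map_usubmx map_dsubmx map_pt_mx.
Qed.

Lemma map_swap_invariants (R S : comNzRingType) (f : {rmorphism R -> S}) y i :
  f (swap_invariants y i) = swap_invariants (f \o y) i.
Proof.
rewrite /swap_invariants.
have -> : pt_matrix (f \o y) = map_mx f (pt_matrix y).
  by rewrite map_vec_mx map_lsubmx; congr (vec_mx (lsubmx _)); apply/rowP=> j; rewrite !mxE.
rewrite map_corner_pt map_patch /conj_sum map_mxD !map_mxZ -map_trmx rmorphM rmorphD.
by rewrite [map_mx f _ 0 0]mxE.
Qed.

Lemma eq_sl_invariants (R : comNzRingType) (x x' : 'I_m -> R) :
  x =1 x' -> sl_invariants x =1 sl_invariants x'.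
Proof.
move=> e i; rewrite /sl_invariants /pairing /vecs /covecs.
by rewrite (eq_pt_mx e).
Qed.

Lemma eq_swap_invariants (R : comNzRingType) y y' :
  y =1 y' -> @swap_invariants R y =1 swap_invariants y'.
Proof.
move=> e i; rewrite /swap_invariants; have -> : pt_scalar y = pt_scalar y' by exact: e.
have -> // : pt_matrix y = pt_matrix y'.
by congr (vec_mx (lsubmx _)); apply/rowP=> j; rewrite !mxE.
Qed.
End Coordinates.

(** * Algebraic independence and invariance of the generators *)

Section Dominance.
Variable n' : nat.
Notation n := n'.+1.
Notation m := ((n + n) * n)%N.
Notation N := (n * n + 1)%N.

(** Solve [det M = d d'] for the corner entry of [M], then take for [X] a
    diagonal matrix of determinant [d] and [Y = X^-T M]. *)
Lemma sl_invariants_surj (K : fieldType) (y : 'I_N -> K) :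
  pt_scalar y != 0 -> minor00 (pt_matrix y) != 0 ->
  exists x : 'I_m -> K, sl_invariants x =1 y.
Proof.
set W := pt_matrix y; set d := pt_scalar y => d0 w0.
pose M := patch W ((d * W 0 0 - \det (patch W 0)) / minor00 W).
have detM : \det M = d * W 0 0 by rewrite det_patch divfK // subrK.
exists (fun i => mxvec (col_mx (first_mx n' d) (first_mx n' d^-1 *m M)) 0 i) => i.
rewrite -[RHS]corner_ptK -/W -/d /sl_invariants /pairing /vecs /covecs pt_mxK col_mxKu col_mxKd.
rewrite tr_first_mx mulmxA first_mxM divff // first_mx1 mul1mx.
rewrite det_mulmx !det_first_mx detM mulKf // patch_patch.
by rewrite patch_id.
Qed.

(** The scalars [d], [d'] are the roots of a quadratic equation with
    discriminant [(d - d')^2]; when it and [d + d'] do not vanish, the entries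
    of [W] are recovered from those of [d W + d' W^T] by solving 2 x 2 systems. *)
Lemma swap_invariants_surj (K : closedFieldType) (z : 'I_N -> K) :
  let s := pt_matrix z 0 0 in
  s != 0 -> s ^+ 2 - 4%:R * pt_scalar z != 0 ->
  exists y : 'I_N -> K, swap_invariants y =1 z.
Proof.
set Z := pt_matrix z; set p := pt_scalar z => s s0 disc.
have [d dP] : exists d, root ('X^2 - s *: 'X + p%:P) d.
  apply/closed_rootP; rewrite -addrA size_polyDl ?size_polyXn //.
  rewrite (leq_ltn_trans (size_polyD _ _)) // size_polyN gtn_max.
  rewrite (leq_ltn_trans (size_scale_leq _ _)) ?size_polyX //=.
  by rewrite (leq_ltn_trans (size_polyC_leq1 _)).
have {dP} dE : p = d * (s - d).
  move: dP; rewrite /root !hornerE => /eqP dP.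
  by apply/eqP; rewrite -subr_eq0 -dP; apply/eqP; ring.
pose d' := s - d.
have dd0 : d - d' != 0.
  have discE : s ^+ 2 - 4%:R * p = (d - d') ^+ 2 by rewrite dE /d'; ring.
  by apply: contraNneq disc => e; rewrite discE e expr0n.
have sE : d + d' = s by rewrite /d'; ring.
rewrite -/d' in dE; clearbody d'.
exists (corner_pt (patch (((d - d') * s)^-1 *: (d *: Z - d' *: Z^T)) d') d) => i.
rewrite -[RHS]corner_ptK -/Z -/p /swap_invariants pt_matrixK pt_scalarK.
have -> : patch (((d - d') * s)^-1 *: (d *: Z - d' *: Z^T)) d' 0 0 = d'.
  by rewrite mxE.
rewrite sE -dE; congr (corner_pt _ _ _); rewrite -[RHS]patch_id -/s.
apply/matrixP => a b; rewrite /conj_sum !mxE [(b == 0) && _]andbC; case: (_ && _) => //.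
by rewrite -sE; field; rewrite sE s0 dd0.
Qed.

Variable k : fieldType.

Definition sl_invariant_polys := [tuple sl_invariants (fun i => 'X_i : {mpoly k[m]}) i | i < N].
Definition swap_invariant_polys := [tuple swap_invariants (fun i => 'X_i : {mpoly k[N]}) i | i < N].

(** The comorphism of the composite of the two maps; its image is generated by
    the invariants. *)
Definition pull (p : {mpoly k[N]}) : {mpoly k[m]} :=
  (p \mPo swap_invariant_polys) \mPo sl_invariant_polys.
HB.instance Definition _ :=
  GRing.RMorphism.copy pull (comp_mpoly sl_invariant_polys \o comp_mpoly swap_invariant_polys).

Lemma mmap_sl_invariant_polys (S : comNzRingType) (f : {rmorphism k -> S}) x i :
  mmap f x (tnth sl_invariant_polys i) = sl_invariants x i.
Proof.
rewrite tnth_mktuple (map_sl_invariants (mmap f x)); apply: eq_sl_invariants => j.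
exact: mmapXU.
Qed.

Lemma mmap_swap_invariant_polys (S : comNzRingType) (f : {rmorphism k -> S}) y i :
  mmap f y (tnth swap_invariant_polys i) = swap_invariants y i.
Proof.
rewrite tnth_mktuple (map_swap_invariants (mmap f y)); apply: eq_swap_invariants => j.
exact: mmapXU.
Qed.

Lemma mmap_pull (S : comNzRingType) (f : {rmorphism k -> S}) x p :
  mmap f x (pull p) = mmap f (swap_invariants (sl_invariants x)) p.
Proof.
rewrite !mmap_comp; apply: eq_mmapr => i.
rewrite mmap_swap_invariant_polys; apply: eq_swap_invariants => j; exact: mmap_sl_invariant_polys.
Qed.

(** The two maps are handled one after the other, so that each open set is
    described in the coordinates of its own target: the minor of [M] is a
    complicated function of the invariants of the involution. *)
Lemma pull_inj (K : closedFieldType) (iota : {rmorphism k -> K}) : injective pull.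
Proof.
apply: raddf_inj => r r0.
have q0 : r \mPo swap_invariant_polys = 0.
  (* the open set of [sl_invariants_surj] *)
  pose h : {mpoly k[N]} := pt_scalar (fun i => 'X_i) * minor00 (pt_matrix (fun i => 'X_i)).
  have hE (S : comNzRingType) (f : {rmorphism k -> S}) (y : 'I_N -> S) :
      mmap f y h = pt_scalar y * minor00 (pt_matrix y).
    rewrite rmorphM; congr (_ * _); first exact: mmapXU.
    rewrite /minor00 -det_map_mx; congr (\det _); apply/matrixP => i j.
    rewrite !mxE; exact: mmapXU.
  apply: (@mpoly_eq0_closed _ _ iota _ _ h) => [|y].
    apply: contraTneq (oner_neq0 k) => h0.
    have := hE _ idfun (corner_pt 1%:M 1); rewrite h0 rmorph0 pt_scalarK pt_matrixK mul1r.
    rewrite /minor00 => ->; rewrite (_ : row' 0 _ = 1%:M) ?det1 ?eqxx //.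
    by apply/matrixP => i j; rewrite !mxE (inj_eq lift_inj).
  rewrite hE mulf_eq0 negb_or => /andP[y1 y2].
  have [x xy] := sl_invariants_surj y1 y2.
  rewrite -(eq_mmapr iota _ xy).
  have -> : mmap iota (sl_invariants x) (r \mPo swap_invariant_polys) = mmap iota x (pull r).
    by rewrite /pull [RHS]mmap_comp; apply: eq_mmapr => i; rewrite mmap_sl_invariant_polys.
  exact: etrans (congr1 (mmap iota x) r0) (rmorph0 (mmap iota x)).
pose s : {mpoly k[N]} := pt_matrix (fun i => 'X_i) 0 0.
(* the open set of [swap_invariants_surj] *)
pose h := s * (s ^+ 2 - 4%:R * pt_scalar (fun i => 'X_i)).
have hE (S : comNzRingType) (f : {rmorphism k -> S}) (z : 'I_N -> S) :
    mmap f z h = pt_matrix z 0 0 * (pt_matrix z 0 0 ^+ 2 - 4%:R * pt_scalar z).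
  have sE : mmap f z s = pt_matrix z 0 0 by rewrite /s !mxE; exact: mmapXU.
  rewrite rmorphM rmorphB rmorphXn [X in _ * (_ - X)]rmorphM rmorph_nat /= sE.
  by congr (_ * (_ - _ * _)); exact: mmapXU.
apply: (@mpoly_eq0_closed _ _ iota _ _ h) => [|z].
  apply: contraTneq (oner_neq0 k) => h0.
  have := hE _ idfun (corner_pt 1%:M 0); rewrite h0 rmorph0 pt_scalarK pt_matrixK.
  by rewrite mxE eqxx mulr0 subr0 expr1n mul1r => <-; rewrite eqxx.
rewrite hE mulf_eq0 negb_or => /andP[z1 z2].
have [y yz] := swap_invariants_surj z1 z2.
rewrite -(eq_mmapr iota _ yz).
have -> : mmap iota (swap_invariants y) r = mmap iota y (r \mPo swap_invariant_polys).
  by rewrite [RHS]mmap_comp; apply: eq_mmapr => i; rewrite mmap_swap_invariant_polys.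
by rewrite q0 rmorph0.
Qed.

(** Over a domain the section [e] of Z/2Z is constant, equal to 0 or 1. *)
Lemma invariants_act (R : idomainType) (g : SLZ2 R n) (x : 'I_m -> R) :
  swap_invariants (sl_invariants (lin_pt (copies_mx n (double_mx g)) x)) =1
  swap_invariants (sl_invariants x).
Proof.
pose A := SLmx (SLZ2_SL g); pose A' := SLmx (SL_trinv (SLZ2_SL g)).
have AA' : A^T *m A' = 1%:M.
  by rewrite -trmx_mul -[RHS]trmx1; congr trmx; apply: SL_adj_mul.
have [dA dA'] : \det A = 1 /\ \det A' = 1 by rewrite /A /A' !det_SL.
have ee := Z2_idem (SLZ2_Z2 g).
have xE : pt_mx x = col_mx (vecs x) (covecs x) by rewrite vsubmxK.
have actE : pt_mx (lin_pt (copies_mx n (double_mx g)) x) =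
    col_mx (A *m ((1 - Z2val (SLZ2_Z2 g)) *: vecs x + Z2val (SLZ2_Z2 g) *: covecs x))
      (A' *m (Z2val (SLZ2_Z2 g) *: vecs x + (1 - Z2val (SLZ2_Z2 g)) *: covecs x)).
  rewrite pt_mx_lin xE mul_block_col -/A -/A' !mulmxDr -!scalemxAl -!scalemxAr.
  by [].
move: ee actE; move: (Z2val _) => e ee actE i.
have /orP[/eqP e0|/eqP e1] : (e == 0) || (e == 1).
  by rewrite -[e == 1]subr_eq0 -mulf_eq0 mulrBr mulr1 ee subrr.
- rewrite /sl_invariants /pairing [in LHS]/vecs [in LHS]/covecs actE col_mxKu col_mxKd.
  rewrite e0 subr0 !scale1r !scale0r addr0 add0r.
  by rewrite trmx_mul mulmxA -[_ *m A']mulmxA AA' mulmx1 !det_mulmx dA dA' !mul1r.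
rewrite /sl_invariants /pairing [in LHS]/vecs [in LHS]/covecs actE col_mxKu col_mxKd.
rewrite e1 subrr !scale1r !scale0r addr0 add0r.
rewrite trmx_mul mulmxA -[_ *m A']mulmxA AA' mulmx1 !det_mulmx dA dA' !mul1r.
rewrite /swap_invariants !pt_matrixK !pt_scalarK.
set d := \det (vecs x); set d' := \det (covecs x); set M := (vecs x)^T *m covecs x.
have -> : (covecs x)^T *m vecs x = M^T by rewrite trmx_mul trmxK.
rewrite !patch00 [d' + d]addrC [d' * d]mulrC.
rewrite !patch_conj_sum /conj_sum trmxK.
by congr (corner_pt (patch _ _) _ _); apply: addrC.
Qed.
End Dominance.

(** * Invariant rational functions *)

Lemma frac_map_fixed (A : idomainType) (phi : {rmorphism A -> A}) (a b : A) :
  injective phi -> b != 0 ->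
  frac_map phi (tofrac a / tofrac b) = tofrac a / tofrac b <->
  phi a * b = a * phi b.
Proof.
move=> phi_inj b0; rewrite frac_map_div //.
have fb0 : phi b != 0 by rewrite raddf_eq0.
split=> [/eqP|e]; last apply/eqP; rewrite eqr_div ?tofrac_eq0 // -!tofracM tofrac_eq.
  by move/eqP.
exact/eqP.
Qed.

Section Invariance.
Variables (k : fieldType) (K : closedFieldType) (iota : {rmorphism k -> K}).

Lemma map_mpoly_inj l : injective (map_mpoly iota : {mpoly k[l]} -> {mpoly K[l]}).
Proof.
move=> p q e; apply/mpolyP => a; apply: (fmorph_inj iota).
by rewrite -!mcoeff_map_mpoly e.
Qed.

Lemma meval_map_mpoly l (x : 'I_l -> K) (p : {mpoly k[l]}) :
  (map_mpoly iota p).@[x] = mmap iota x p.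
Proof. exact: (mmap_map_mpoly iota idfun). Qed.

Lemma meval_lin_subst l (A : 'M[K]_l) x p :
  (lin_subst A p).@[x] = p.@[lin_pt A x].
Proof.
rewrite comp_mpoly_meval; apply: meval_eq => i; rewrite tnth_mktuple raddf_sum.
by apply: eq_bigr => j _; rewrite /= mevalZ mevalXU.
Qed.

Lemma lin_subst_inj l (A B : 'M[K]_l) : A *m B = 1%:M -> injective (lin_subst A).
Proof.
move=> AB1; pose f : {rmorphism _ -> _} :=
  comp_mpoly [tuple \sum_(j < l) A i j *: 'X_j | i < l] : {mpoly K[l]} -> {mpoly K[l]}.
apply: (raddf_inj (f := f)) => p p0.
apply: (@mpoly_eq0_closed K K idfun l p 1) => [|x _]; first exact: oner_neq0.
have -> : mmap idfun x p = p.@[lin_pt A (lin_pt B x)].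
  by apply: meval_eq => i; rewrite lin_ptM AB1 lin_pt1.
by rewrite -meval_lin_subst [lin_subst A p]p0 rmorph0.
Qed.

(** Invariance of a fraction becomes an identity without denominators between
    values at points of an algebraically closed field. *)
Lemma invariant_ratfunP (G : group_functor k) l (rho : representation G l)
    (a b : {mpoly k[l]}) : b != 0 ->
  invariant_ratfun iota rho (tofrac a / tofrac b) <->
  forall (g : G (kbar_alg iota)) (x : 'I_l -> K),
    let gx := lin_pt (rho _ g) x in
    mmap iota gx a * mmap iota x b = mmap iota x a * mmap iota gx b.
Proof.
move=> b0; rewrite /invariant_ratfun.
have bb0 : map_mpoly iota b != 0 by rewrite raddf_eq0 //; apply: map_mpoly_inj.
rewrite (frac_map_div (@map_mpoly_inj l)) //.
have substE (g : G (kbar_alg iota)) :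
    frac_map (lin_subst (rho _ g)) (tofrac (map_mpoly iota a) / tofrac (map_mpoly iota b)) =
      tofrac (map_mpoly iota a) / tofrac (map_mpoly iota b) <->
    lin_subst (rho _ g) (map_mpoly iota a) * map_mpoly iota b =
      map_mpoly iota a * lin_subst (rho _ g) (map_mpoly iota b).
  pose f : {rmorphism {mpoly K[l]} -> {mpoly K[l]}} :=
    comp_mpoly [tuple \sum_(j < l) (rho _ g : 'M[K]_l) i j *: 'X_j | i < l].
  have f_inj : injective f.
    apply: (@lin_subst_inj _ _ (rho _ g^-1%g : 'M[K]_l)).
    have := rep_mxM rho g g^-1%g; rewrite mulgV rep_mx1 => <-.
    by [].
  exact: (frac_map_fixed _ f_inj bb0).
have evalE (g : G (kbar_alg iota)) (x : 'I_l -> K) p q :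
    (lin_subst (rho _ g) (map_mpoly iota p) * map_mpoly iota q).@[x] =
    mmap iota (lin_pt (rho _ g) x) p * mmap iota x q.
  by rewrite mevalM meval_lin_subst !meval_map_mpoly.
split=> [inv g x /=|inv g].
  have /substE/(congr1 (meval x)) := inv g.
  by rewrite evalE [in RHS]mulrC evalE => ->; rewrite mulrC.
apply/substE/eqP; rewrite -subr_eq0; apply/eqP.
apply: (@mpoly_eq0_closed K K idfun l _ 1) => [|x _]; first exact: oner_neq0.
change ((lin_subst (rho _ g) (map_mpoly iota a) * map_mpoly iota b
  - map_mpoly iota a * lin_subst (rho _ g) (map_mpoly iota b)).@[x] = 0).
rewrite mevalB evalE [X in _ - X.@[x]]mulrC evalE; apply/eqP; rewrite subr_eq0 [X in _ == X]mulrC.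
exact/eqP/inv.
Qed.
End Invariance.

(** * Generic freeness *)

Section GenericFreeness.
Variable n' : nat.
Notation n := n'.+1.
Notation m := ((n + n) * n)%N.

(** Let [(A, e)] fix [(X, Y)].  Multiplying the equation for [X] by
    the idempotent [e] gives [A (e Y) = e X], so [e (det X - det Y) = 0] and
    [e = 0] because [det X - det Y] is a unit.  Then [A X = X] with [X] invertible. *)
Lemma pairs_generically_free (k : fieldType) (K : closedFieldType)
    (iota : {rmorphism k -> K}) : generically_free iota (pairs_rep k n).
Proof.
pose X := vecs (fun i => 'X_i : {mpoly K[m]}).
pose Y := covecs (fun i => 'X_i : {mpoly K[m]}).
pose h := \det X * (\det X - \det Y).
have hE x : h.@[x] = \det (vecs x) * (\det (vecs x) - \det (covecs x)).
  have E : map_mx (meval x) (pt_mx (fun i => 'X_i)) = pt_mx x.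
    by rewrite map_pt_mx; congr vec_mx; apply/rowP => i; rewrite !mxE /= mevalXU.
  by rewrite rmorphM rmorphB /= -!det_map_mx map_usubmx map_dsubmx E.
exists h.
  (* [X = diag(c, 1, ..., 1)], [Y = 1] with [c] different from 0 and 1 *)
  have [c _] := @closed_infinite K [:: 0; 1]; rewrite !inE negb_or => /andP[c0 c1].
  pose x i := mxvec (col_mx (first_mx n' c) 1%:M) 0 i.
  apply: contraNneq (mulf_neq0 c0 (etrans (congr1 negb (subr_eq0 c 1)) c1)) => h0.
  have := hE x; rewrite h0 rmorph0 /vecs /covecs pt_mxK col_mxKu col_mxKd.
  by rewrite det_first_mx det1 => <-.
move=> v; rewrite hE mulf_eq0 negb_or; set x := fun i => v i 0.
case/andP=> dX dXY R [A e] /=; set f := kalg_str R => fix_v.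
pose x' := f \o x.
have xE : map_mx f v = \col_i x' i by apply/colP => i; rewrite !mxE.
have fixE : double_mx (MkSLZ2 A e) *m pt_mx x' = pt_mx x'.
  rewrite -pt_mx_lin; congr vec_mx; apply/rowP => i; rewrite mxE lin_ptE.
  by rewrite -xE [LHS](congr1 (fun u : 'cV_m => u i 0) fix_v) xE !mxE.
have [fX fY] : \det (vecs x') = f (\det (vecs x)) /\ \det (covecs x') = f (\det (covecs x)).
  by rewrite -!det_map_mx map_usubmx map_dsubmx map_pt_mx.
have f_inv c : c != 0 -> f c * f c^-1 = 1 by move=> c0; rewrite -rmorphM divff ?rmorph1.
have : col_mx (SLmx A *m ((1 - Z2val e) *: vecs x' + Z2val e *: covecs x'))
    (SLmx (SL_trinv A) *m (Z2val e *: vecs x' + (1 - Z2val e) *: covecs x')) =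
    col_mx (vecs x') (covecs x').
  rewrite [RHS]vsubmxK -fixE -[in RHS](vsubmxK (pt_mx x')) mul_block_col.
  by rewrite !mulmxDr -!scalemxAl -!scalemxAr.
case/eq_col_mx => fixX _.
have ee := Z2_idem e; move: ee fixX; case: e {fix_v fixE} => a a_idem /= aa fixX.
have aX : SLmx A *m (a *: covecs x') = a *: vecs x'.
  rewrite -{1}fixX scalemxAr scalerDr !scalerA mulrBr mulr1 aa subrr scale0r add0r.
  by [].
have a0 : a = 0.
  have := congr1 determinant aX; rewrite det_mulmx det_SL mul1r !detZ => /eqP.
  have -> : a ^+ n = a.
    by elim: (n') => [|j IH]; rewrite ?expr1 // exprS IH.
  rewrite eq_sym -subr_eq0 -mulrBr fX fY -rmorphB => /eqP a0.
  by rewrite -[a]mulr1 -(f_inv _ dXY) mulrA a0 mul0r.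
have A1 : SLmx A = 1%:M.
  move: fixX; rewrite a0 subr0 scale1r scale0r addr0 => fixX.
  have := congr1 (fun B => B *m \adj (vecs x')) fixX.
  rewrite -mulmxA mul_mx_adj mul_mx_scalar fX => /(congr1 (fun B => f (\det (vecs x))^-1 *: B)).
  by rewrite -[in RHS]scalemx1 !scalerA [_ * f (\det _)]mulrC f_inv // !scale1r.
congr MkSLZ2; apply: val_inj => //.
Qed.
End GenericFreeness.

(** * Homogenized evaluation *)

Section Homogenization.
Variable l : nat.

(** Denotes [u^e p(t / u)], written without division: this is how rational
    points [t / u] are handled in rings where [u] is not invertible. *)
Definition homeval (R S : comNzRingType) (f : R -> S) e (p : {mpoly R[l]})
    (u : S) (t : 'I_l -> S) : S :=
  \sum_(a <- msupp p) f p@_a * u ^+ (e - mdeg a) * mmap1 t a.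

Lemma homeval_scale (R S : comNzRingType) (f : {rmorphism R -> S}) e (p : {mpoly R[l]}) u t x :
  (msize p <= e)%N -> (forall i, t i = u * x i) ->
  homeval f e p u t = u ^+ e * mmap f x p.
Proof.
move=> pe tE; rewrite /mmap mulr_sumr; apply: eq_big_seq => a ap.
have ae : (mdeg a <= e)%N by apply: leq_trans pe; apply/ltnW/msize_mdeg_lt.
have -> : mmap1 t a = u ^+ mdeg a * mmap1 x a.
  rewrite mdegE expr_sum -big_split /=; apply: eq_bigr => i _.
  by rewrite tE exprMn.
by rewrite -{2}(subnK ae) exprD; ring.
Qed.

Lemma rmorph_homeval (R S T : comNzRingType) (f : {rmorphism R -> S}) (g : {rmorphism S -> T})
    e (p : {mpoly R[l]}) u t :
  g (homeval f e p u t) = homeval (g \o f) e p (g u) (g \o t).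
Proof.
rewrite rmorph_sum; apply: eq_bigr => a _; rewrite !rmorphM rmorphXn rmorph_prod.
by congr (_ * _); apply: eq_bigr => i _; rewrite rmorphXn.
Qed.

Lemma eq_homeval (R S : comNzRingType) (f f' : R -> S) e (p : {mpoly R[l]}) u u' t t' :
  f =1 f' -> u = u' -> t =1 t' -> homeval f e p u t = homeval f' e p u' t'.
Proof.
move=> ef -> et; apply: eq_bigr => a _; rewrite ef; congr (_ * _).
exact: mmap1_eq.
Qed.
End Homogenization.

(** * Relations compatible with the ring operations *)

Section RingRelation.
Variables (L : comNzRingType) (G : L -> L -> Prop).
Record ring_relation : Prop := RingRelation {
  rel_opp : forall x x', G x x' -> G (- x) (- x');
  rel_add : forall x x' y y', G x x' -> G y y' -> G (x + y) (x' + y');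
  rel_mul : forall x x' y y', G x x' -> G y y' -> G (x * y) (x' * y');
  rel_one : G 1 1
}.
Hypothesis relG : ring_relation.

Definition mx_rel p q (A A' : 'M[L]_(p, q)) := forall i j, G (A i j) (A' i j).

Lemma rel_zero : G 0 0.
Proof. by rewrite -(subrr 1); apply: rel_add => //; [|apply: rel_opp]; try exact: rel_one. Qed.

Lemma rel_sum I (r : seq I) (P : pred I) (u u' : I -> L) :
  (forall i, G (u i) (u' i)) -> G (\sum_(i <- r | P i) u i) (\sum_(i <- r | P i) u' i).
Proof. by move=> h; elim/big_ind2: _ => //; [exact: rel_zero | move=> *; exact: rel_add]. Qed.

Lemma rel_prod I (r : seq I) (P : pred I) (u u' : I -> L) :
  (forall i, G (u i) (u' i)) -> G (\prod_(i <- r | P i) u i) (\prod_(i <- r | P i) u' i).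
Proof. by move=> h; elim/big_ind2: _ => //; [exact: rel_one | move=> *; exact: rel_mul]. Qed.

Lemma rel_exp x x' i : G x x' -> G (x ^+ i) (x' ^+ i).
Proof.
move=> h; elim: i => [|i IH]; first exact: rel_one.
by rewrite !exprS; apply: rel_mul.
Qed.

Lemma rel_sign i : G ((-1) ^+ i) ((-1) ^+ i).
Proof. by apply/rel_exp/rel_opp => //; apply: rel_one. Qed.

Lemma rel_mulmx p q r (A A' : 'M_(p, q)) (B B' : 'M_(q, r)) :
  mx_rel A A' -> mx_rel B B' -> mx_rel (A *m B) (A' *m B').
Proof. by move=> hA hB i j; rewrite !mxE; apply: rel_sum => a; apply: rel_mul. Qed.

Lemma rel_det p (A A' : 'M_p) : mx_rel A A' -> G (\det A) (\det A').
Proof.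
move=> hA; apply: rel_sum => s; apply: rel_mul => //; first exact: rel_sign.
by apply: rel_prod => i.
Qed.

Lemma rel_adj p (A A' : 'M_p) : mx_rel A A' -> mx_rel (\adj A) (\adj A').
Proof.
move=> hA i j; rewrite !mxE; apply: rel_mul => //; first exact: rel_sign.
by apply: rel_det => a b; rewrite !mxE.
Qed.

Lemma rel_homeval (k : comNzRingType) (f : k -> L) l e (p : {mpoly k[l]}) u u' t t' :
  (forall c, G (f c) (f c)) -> G u u' -> (forall i, G (t i) (t' i)) ->
  G (homeval f e p u t) (homeval f e p u' t').
Proof.
move=> hf hu ht; apply: rel_sum => a; apply: rel_mul => //.
  by apply: rel_mul => //; apply: rel_exp.
by apply: rel_prod => i; apply: rel_exp.
Qed.
End RingRelation.

(** * Descent along a quadratic extension *)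

Section ConjugateRelation.
Variables (F L : fieldType) (j : {rmorphism F -> L}) (d d' : L) (s p : F).
Hypotheses (js : j s = d + d') (jp : j p = d * d').
Hypotheses (dd' : d - d' != 0) (s0 : d + d' != 0).

(** Both [u] and [u'] are conjugate elements of [F(d)]: [u'] is the image of
    [u] under [d |-> d'].  Working with a relation avoids the construction of
    the conjugation on a subfield of [L]. *)
Definition conj_rel (u u' : L) :=
  exists a b, u = j a + j b * d /\ u' = j a + j b * d'.

Lemma conj_rel_const a : conj_rel (j a) (j a).
Proof. by exists a, 0; rewrite rmorph0 !mul0r addr0. Qed.

Lemma conj_rel_ring : ring_relation conj_rel.
Proof.
split=> [_ _ [a [b [-> ->]]] | _ _ _ _ [a [b [-> ->]]] [a' [b' [-> ->]]]
  | _ _ _ _ [a [b [-> ->]]] [a' [b' [-> ->]]] | ].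
- by exists (- a), (- b); rewrite !rmorphN !mulNr !opprD.
- by exists (a + a'), (b + b'); rewrite !rmorphD; split; ring.
- exists (a * a' - b * b' * p), (a * b' + b * a' + b * b' * s).
  by rewrite !(rmorphD, rmorphN, rmorphM) js jp; split; ring.
- by rewrite -(rmorph1 j); apply: conj_rel_const.
Qed.

Lemma conj_rel_swap u u' : conj_rel u u' -> conj_rel u' u.
Proof.
case=> a [b [-> ->]]; exists (a + b * s), (- b).
by rewrite !(rmorphD, rmorphN, rmorphM) js; split; ring.
Qed.

Lemma conj_rel_root : conj_rel d d'.
Proof. by exists 0, 1; rewrite rmorph0 rmorph1 !mul1r !add0r. Qed.

(** A self-conjugate element has no component along [d], as [d <> d']. *)
Lemma conj_rel_same u : conj_rel u u -> exists a, u = j a.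
Proof.
case=> a [b [uE uE']]; exists a; rewrite uE.
have : j b * (d - d') = 0.
  rewrite mulrBr; apply/eqP; by rewrite subr_eq0 -(inj_eq (addrI (j a))) -uE -uE'.
by move/eqP; rewrite mulf_eq0 (negPf dd') orbF => /eqP ->; rewrite mul0r addr0.
Qed.

Lemma conj_rel_div u u' a : a != 0 -> conj_rel (u * j a) (u' * j a) -> conj_rel u u'.
Proof.
move=> a0 h; have ja0 : j a != 0 by rewrite fmorph_eq0.
rewrite -[u](mulfK ja0) -[u'](mulfK ja0) -fmorphV.
exact: (rel_mul conj_rel_ring h (conj_rel_const _)).
Qed.

(** A 2 x 2 linear system solved by Cramer's rule; multiplying by
    [(d + d') (d - d')^2], which lies in [F], keeps the computation polynomial. *)
Lemma conj_rel_solve u u' z z' :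
  j z = d * u + d' * u' -> j z' = d * u' + d' * u -> conj_rel u u'.
Proof.
move=> zE zE'.
have disc : j (s * (s * s - 4%:R * p)) = (d + d') * ((d - d') * (d - d')).
  by rewrite !(rmorphM, rmorphB, rmorph_nat) js jp; ring.
apply: (@conj_rel_div _ _ (s * (s * s - 4%:R * p))).
  by rewrite -(fmorph_eq0 j) disc !mulf_neq0.
have R := conj_rel_ring; have dd := conj_rel_root; have dd1 := conj_rel_swap dd.
rewrite disc.
have -> : u * ((d + d') * ((d - d') * (d - d'))) = (d - d') * (d * j z - d' * j z').
  by rewrite zE zE'; ring.
have -> : u' * ((d + d') * ((d - d') * (d - d'))) = (d' - d) * (d' * j z - d * j z').
  by rewrite zE zE'; ring.
have c := conj_rel_const.
by apply: rel_mul => //; apply: rel_add => //; try apply: rel_opp => //; try apply: rel_mul.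
Qed.

(** Comparing [x (a' + b' d) = a + b d] with its conjugate gives [x b' = b] and
    [x a' = a], and [a'], [b'] are not both zero. *)
Lemma conj_rel_descent x u u' v v' :
  conj_rel u u' -> conj_rel v v' -> x * v = u -> x * v' = u' -> v != 0 ->
  exists a, x = j a.
Proof.
case=> a [b [-> ->]] [a' [b' [vE ->]]]; rewrite {v}vE => e e' v0.
have eb : x * j b' = j b.
  apply: (mulIf dd').
  have -> : x * j b' * (d - d') = x * (j a' + j b' * d) - x * (j a' + j b' * d') by ring.
  by rewrite e e'; ring.
have ea : x * j a' = j a.
  by move: e; rewrite mulrDr mulrA eb => /addIr.
have [b0|b0] := eqVneq b' 0; last first.
  by exists (b / b'); rewrite fmorph_div -eb mulfK // fmorph_eq0.
exists (a / a'); rewrite fmorph_div -ea mulfK // fmorph_eq0.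
by apply: contraNneq v0 => ->; rewrite b0 !rmorph0 mul0r addr0.
Qed.
End ConjugateRelation.

(** For the off-corner entries this is [conj_rel_solve].  The corner entry is
    the quotient of [d d' - det (patch M 0)] by the complementary minor, and
    both are invariant under transposition of [M], hence lie in [F]. *)
Lemma conj_rel_entries n' (F L : fieldType) (j : {rmorphism F -> L}) (d d' : L) (s p : F)
    (Z : 'M[F]_n'.+1) (M : 'M[L]_n'.+1) :
  j s = d + d' -> j p = d * d' -> d - d' != 0 -> d + d' != 0 ->
  \det M = d * d' -> minor00 M != 0 ->
  (forall a b, (a != 0) || (b != 0) -> j (Z a b) = d * M a b + d' * M b a) ->
  mx_rel (conj_rel j d d') M M^T.
Proof.
move=> js jp dd' s0 detM minor0 ZE.
have R := conj_rel_ring js jp.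
have off a b : (a != 0) || (b != 0) -> conj_rel j d d' (M a b) (M b a).
  by move=> ab; apply: (conj_rel_solve js jp dd' s0 (ZE a b ab) (ZE b a _)); rewrite orbC.
have offT : mx_rel (conj_rel j d d') (patch M 0) (patch M^T 0).
  move=> a b; rewrite !mxE; case: ifPn => [_|]; first exact: rel_zero.
  by rewrite negb_and; apply: off.
(* transposing [M] does not change the minor, which is thus self-conjugate *)
have minorG : conj_rel j d d' (minor00 M) (minor00 M).
  rewrite -[X in conj_rel _ _ _ _ X]minor00_tr -(minor00_patch M 0) -(minor00_patch M^T 0).
  by apply: rel_det => // a b; rewrite !mxE; apply: (off (lift 0 a)).
have [c cE] := conj_rel_same dd' minorG.
move=> a b; rewrite mxE.
have [ab|] := boolP ((a != 0) || (b != 0)); first exact: off.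
rewrite negb_or !negbK => /andP[/eqP-> /eqP->].
apply: (@conj_rel_div _ _ j d d' s p js jp _ _ c); first by rewrite -(fmorph_eq0 j) -cE.
have -> : M 0 0 * j c = j p - \det (patch M 0).
  by rewrite jp -detM -cE; have := det_patch M (M 0 0); rewrite patch_id => ->; rewrite addrK.
apply: rel_add => //; first exact: conj_rel_const.
by apply: rel_opp => //; rewrite -{2}det_tr tr_patch; apply: rel_det.
Qed.

(** * Points of an orbit with coordinates in the field of invariants *)

Section OrbitSection.
Variable n' : nat.
Notation n := n'.+1.
Notation m := ((n + n) * n)%N.
Notation N := (n * n + 1)%N.

Section Ring.
Variable R : comNzRingType.
Implicit Types (B M : 'M[R]_n) (d : R).

Definition two_diag u v : 'M[R]_n := diag_mx (\row_i if i == 0 then u else v).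

Lemma two_diag_scale c : two_diag c c = c%:M.
Proof. by rewrite -diag_const_mx; congr diag_mx; apply/rowP => i; rewrite !mxE if_same. Qed.

Lemma two_diag_first u v c : u = v * c -> two_diag u v = v *: first_mx n' c.
Proof.
move=> ->; apply/matrixP => i j; rewrite !mxE mulrnAr; congr (_ *+ _).
by case: ifP => _; rewrite ?mulr1.
Qed.

(** The point [(X_s, Y_s)] with [X_s = diag(d / det B, 1, ..., 1) B] and
    [Y_s = X_s^-T M], multiplied by the common denominator [d det B].  It has the
    invariants of [(X, Y)] when [M = X^T Y] and [d = det X], whence it is in the
    orbit, and its coordinates are polynomials in [B], [d] and [M]. *)
Definition orbit_pt B d M : 'I_m -> R := fun i => mxvec
  (col_mx (two_diag (d * d) (d * \det B) *m B) (two_diag (\det B) d *m (\adj B)^T *m M)) 0 i.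

(** With [B = X] the construction returns the original point; the factor is
    the common denominator [d det X]. *)
Lemma orbit_pt_self (x : 'I_m -> R) i :
  orbit_pt (vecs x) (\det (vecs x)) (pairing x) i = \det (vecs x) * \det (vecs x) * x i.
Proof.
rewrite /orbit_pt !two_diag_scale -mulmxA [_^T *m _]mulmxA -trmx_mul mul_mx_adj tr_scalar_mx.
rewrite !mul_scalar_mx scalerA -scale_col_mx vsubmxK linearZ /= mxE vec_mxK.
by rewrite mxE.
Qed.
End Ring.

Lemma map_two_diag (R S : comNzRingType) (f : {rmorphism R -> S}) u v :
  map_mx f (two_diag u v) = two_diag (f u) (f v).
Proof.
rewrite map_diag_mx; congr diag_mx; apply/rowP => i; rewrite !mxE.
by case: ifP.
Qed.

Lemma map_orbit_pt (R S : comNzRingType) (f : {rmorphism R -> S}) B d M i :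
  f (orbit_pt B d M i) = orbit_pt (map_mx f B) (f d) (map_mx f M) i.
Proof.
rewrite /orbit_pt !det_map_mx -!rmorphM -!map_two_diag -map_mx_adj map_trmx.
by rewrite -!map_mxM -map_col_mx -map_mxvec [RHS]mxE.
Qed.

(** The determinant [d] at the point itself or, for [sw = true], at its image
    [(Y, X)] under [tau]. *)
Definition side_det (R : comNzRingType) (sw : bool) (x : 'I_m -> R) :=
  if sw then \det (covecs x) else \det (vecs x).
Definition side_pairing (R : comNzRingType) (sw : bool) (x : 'I_m -> R) :=
  if sw then (pairing x)^T else pairing x.

Lemma map_pairing (R S : comNzRingType) (f : {rmorphism R -> S}) (x : 'I_m -> R) :
  map_mx f (pairing x) = pairing (f \o x).
Proof. by rewrite map_mxM -map_trmx map_usubmx map_dsubmx map_pt_mx. Qed.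

Lemma map_side_det (R S : comNzRingType) (f : {rmorphism R -> S}) sw x :
  f (side_det sw x) = side_det sw (f \o x).
Proof.
by case: sw; rewrite /side_det -det_map_mx ?map_usubmx ?map_dsubmx map_pt_mx.
Qed.

Lemma map_side_pairing (R S : comNzRingType) (f : {rmorphism R -> S}) sw x :
  map_mx f (side_pairing sw x) = side_pairing sw (f \o x).
Proof. by case: sw; rewrite /side_pairing -?map_trmx map_pairing. Qed.

(** The element of SL_n is [X_s X^-1]; its action on the second component
    is correct because [X_s^T Y_s = M = X^T Y]. *)
Lemma orbit_pt_in_orbit (K : fieldType) sw (x : 'I_m -> K) (B : 'M[K]_n) :
  side_det sw x != 0 -> \det B != 0 ->
  exists g : SLZ2 K n, forall i,
    orbit_pt B (side_det sw x) (side_pairing sw x) i =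
    side_det sw x * \det B * lin_pt (copies_mx n (double_mx g)) x i.
Proof.
set d := side_det sw x; set b := \det B => d0 b0.
pose X := if sw then covecs x else vecs x; pose Y := if sw then vecs x else covecs x.
have dE : d = \det X by rewrite /d /X; case: (sw).
have ME : side_pairing sw x = X^T *m Y.
  by rewrite /side_pairing /X /Y; case: (sw); rewrite // trmx_mul trmxK.
pose Xs := first_mx n' (d / b) *m B.
pose Ys := first_mx n' (b / d) *m (b^-1 *: \adj B)^T *m (X^T *m Y).
have detXs : \det Xs = d by rewrite det_mulmx det_first_mx divfK.
have Xu : X \in unitmx by rewrite unitmxE unitfE -dE.
have A1 : \det (Xs *m invmx X) == 1.
  by rewrite det_mulmx detXs det_inv -dE divff.
pose A := MkSL A1; pose e : Z2 K := if sw then Z2_tau K else 1%g.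
exists (MkSLZ2 A e) => i.
have AX : SLmx A *m X = Xs by rewrite /= mulmxKV.
have AY : SLmx (SL_trinv A) *m Y = Ys.
  have AT : (SLmx A)^T *m Ys = Y.
    have XsYs : Xs^T *m Ys = X^T *m Y.
      rewrite trmx_mul tr_first_mx /Ys !mulmxA -[_ *m first_mx _ _ *m first_mx _ _]mulmxA first_mxM.
      rewrite mulrA divfK // divff // first_mx1 mulmx1 -trmx_mul -scalemxAl mul_adj_mx.
      by rewrite scale_scalar_mx mulVf // trmx1 mul1mx.
    rewrite [SLmx A]/= trmx_mul -mulmxA XsYs trmx_inv mulKmx //.
    by rewrite unitmx_tr.
  rewrite -{1}AT mulmxA -trmx_mul [X in X^T](_ : _ = 1%:M) ?trmx1 ?mul1mx //.
  by rewrite mul_mx_adj det_SL.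
rewrite /orbit_pt.
have <- : mxvec ((d * b) *: pt_mx (lin_pt (copies_mx n (double_mx (MkSLZ2 A e))) x)) 0 i =
    d * b * lin_pt (copies_mx n (double_mx (MkSLZ2 A e))) x i.
  by rewrite linearZ /= mxE vec_mxK mxE.
congr (mxvec _ 0 i); rewrite pt_mx_lin -[pt_mx x]vsubmxK -/(vecs x) -/(covecs x) mul_block_col.
have -> : SLZ2_Z2 (MkSLZ2 A e) = e by [].
have -> : SLZ2_SL (MkSLZ2 A e) = A by [].
rewrite -!scalemxAl ME scale_col_mx.
have XsE : two_diag (d * d) (d * b) *m B = (d * b) *: Xs.
  by rewrite (@two_diag_first _ _ _ (d / b)) ?scalemxAl //; field.
have YsE : two_diag b d *m (\adj B)^T *m (X^T *m Y) = (d * b) *: Ys.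
  rewrite (@two_diag_first _ _ _ (b / d)); last by field.
  rewrite /Ys linearZ /= -!scalemxAr -!scalemxAl scalerA.
  by congr (_ *: _); field.
rewrite XsE YsE -AX -AY /X /Y /e; congr (col_mx (_ *: _) (_ *: _)); case: (sw) => /=.
- by rewrite subrr scale0r scale1r add0r.
- by rewrite subr0 scale0r scale1r addr0.
- by rewrite subrr scale0r scale1r addr0.
- by rewrite subr0 scale0r scale1r add0r.
Qed.

Variables (k : fieldType) (K : closedFieldType) (iota : {rmorphism k -> K}).
Variables (a b : {mpoly k[m]}) (e : nat).
Hypotheses (ae : (msize a <= e)%N) (be : (msize b <= e)%N).
Hypothesis inv : forall (g : SLZ2 K n) (x : 'I_m -> K),
  let gx := lin_pt (copies_mx n (double_mx g)) x in
  mmap iota gx a * mmap iota x b = mmap iota x a * mmap iota gx b.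

(** Up to a power of the common denominator, the value of [p] at the point of the
    orbit given by [B]. *)
Definition homeval_orbit (S : comNzRingType) (f : {rmorphism k -> S})
    (p : {mpoly k[m]}) sw (x : 'I_m -> S) B :=
  homeval f e p (side_det sw x * \det B) (orbit_pt B (side_det sw x) (side_pairing sw x)).

Definition orbit_defect (S : comNzRingType) (f : {rmorphism k -> S}) sw (x : 'I_m -> S) B :=
  homeval_orbit f a sw x B * mmap f x b - mmap f x a * homeval_orbit f b sw x B.

Lemma orbit_defect_closed sw (x : 'I_m -> K) B :
  side_det sw x != 0 -> \det B != 0 -> orbit_defect iota sw x B = 0.
Proof.
move=> d0 b0; have [g gE] := orbit_pt_in_orbit d0 b0.
rewrite /orbit_defect /homeval_orbit (homeval_scale _ ae gE) (homeval_scale _ be gE).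
by apply/eqP; rewrite subr_eq0 mulrCA -mulrA (inv g x) mulrCA.
Qed.

Lemma map_orbit_defect (S T : comNzRingType) (f : {rmorphism k -> S}) (g : {rmorphism S -> T})
    (h : {rmorphism k -> T}) sw x B y :
  g \o f =1 h -> g \o x =1 y ->
  g (orbit_defect f sw x B) = orbit_defect h sw y (map_mx g B).
Proof.
move=> fh xy; have dE : g (side_det sw x) = side_det sw y.
  by rewrite map_side_det /side_det /vecs /covecs (eq_pt_mx xy).
have pE : map_mx g (side_pairing sw x) = side_pairing sw y.
  by rewrite map_side_pairing /side_pairing /pairing /vecs /covecs (eq_pt_mx xy).
have orbE p : g (homeval_orbit f p sw x B) = homeval_orbit h p sw y (map_mx g B).
  rewrite rmorph_homeval; apply: eq_homeval => //.
    by rewrite rmorphM dE -det_map_mx.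
  by move=> i /=; rewrite map_orbit_pt dE pE.
have mE p : g (mmap f x p) = mmap h y p.
  by rewrite rmorph_mmap; apply: (@eq_mmap _ _ _ (g \o f)).
by rewrite rmorphB !rmorphM !orbE !mE.
Qed.

(** The identity [a(g x) b(x) = a(x) b(g x)] at [g x = orbit_pt], without
    denominators.  It holds for points of an algebraically closed field with
    [d det B <> 0], hence for all points with values in any [k]-algebra. *)
Lemma orbit_identity (S : comNzRingType) (f : {rmorphism k -> S}) sw (x : 'I_m -> S) B :
  homeval_orbit f a sw x B * mmap f x b = mmap f x a * homeval_orbit f b sw x B.
Proof.
(* the identity is tested in the universal case: all entries of [X], [Y] and [B]
   are variables *)
pose T := {mpoly k[m + n * n]}.
pose C : {rmorphism k -> T} := @mpolyC (m + n * n) k.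
pose xg (i : 'I_m) : T := 'X_(lshift (n * n) i).
pose Bg : 'M[T]_n := \matrix_(i, j) 'X_(rshift m (mxvec_index i j)).
have specE (S' : comNzRingType) (f' : {rmorphism k -> S'}) w x' :
    (forall i, w (lshift (n * n) i) = x' i) -> 
    mmap f' w (orbit_defect C sw xg Bg) =
      orbit_defect f' sw x' (\matrix_(i, j) w (rshift m (mxvec_index i j))).
  move=> wx; rewrite (@map_orbit_defect _ _ C (mmap f' w) f' _ _ _ x').
  - congr (orbit_defect _ _ _ _); apply/matrixP => i j; rewrite !mxE.
    exact: mmapXU.
  - by move=> c; apply: mmapC.
  - by move=> i; rewrite -wx; apply: mmapXU.
suff zero : orbit_defect C sw xg Bg = 0.
  pose w (i : 'I_(m + n * n)) := match split i with inl i => x i | inr i => mxvec B 0 i end.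
  have wl i : w (lshift (n * n) i) = x i by rewrite /w (unsplitK (inl i)).
  have := specE S f w x wl; rewrite zero rmorph0.
  rewrite (_ : \matrix_(i, j) _ = B); first by move/esym/eqP; rewrite subr_eq0 => /eqP.
  by apply/matrixP => i j; rewrite mxE /w (unsplitK (inr _)) mxvecE.
pose h := side_det sw xg * \det Bg.
have hE (S' : comNzRingType) (f' : {rmorphism k -> S'}) w :
    mmap f' w h = side_det sw (fun i => w (lshift (n * n) i)) *
      \det (\matrix_(i, j) w (rshift m (mxvec_index i j))).
  rewrite rmorphM (map_side_det (mmap f' w)) -[X in _ * X]det_map_mx; congr (_ * _).
    have ex : mmap f' w \o xg =1 (fun i => w (lshift (n * n) i)) by move=> i; apply: mmapXU.
    by rewrite /side_det /vecs /covecs (eq_pt_mx ex).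
  congr (\det _); apply/matrixP => i j; rewrite !mxE; exact: mmapXU.
apply: (@mpoly_eq0_closed _ _ iota _ _ h) => [|w].
  apply: contraTneq (oner_neq0 k) => h0.
  pose w (i : 'I_(m + n * n)) : k := match split i with
    | inl i => mxvec (col_mx 1%:M 1%:M : 'M_(n + n, n)) 0 i | inr i => mxvec (1%:M : 'M_n) 0 i end.
  have := hE _ idfun w; rewrite h0 rmorph0.
  have -> : side_det sw (fun i => w (lshift (n * n) i)) = 1.
    have ew : (fun i => w (lshift (n * n) i)) =1
        (fun i => mxvec (col_mx 1%:M 1%:M : 'M_(n + n, n)) 0 i).
      by move=> i; rewrite /w (unsplitK (inl i)).
    by rewrite /side_det /vecs /covecs (eq_pt_mx ew) pt_mxK col_mxKu col_mxKd det1; case: (sw).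
  rewrite (_ : \matrix_(i, j) _ = 1%:M); first by rewrite det1 mulr1 => <-; rewrite eqxx.
  by apply/matrixP => i j; rewrite mxE /w (unsplitK (inr _)) mxvecE.
rewrite hE mulf_eq0 negb_or => /andP[h1 h2].
by rewrite (specE _ iota w (fun i => w (lshift (n * n) i))) // orbit_defect_closed.
Qed.

End OrbitSection.

(** * The field of invariants *)

Lemma infinite_in_pow (R : idomainType) (t : R) (P : R -> Prop) :
  (forall i, P (t ^+ i)) -> injective (fun i : nat => t ^+ i) -> infinite_in P.
Proof.
move=> Pt t_inj s.
have /allPn[x /mapP[i _ ->] xs] : ~~ all (mem s) [seq t ^+ i | i <- iota 0 (size s).+1].
  apply/negP => /allP sub.
  have := uniq_leq_size _ sub; rewrite size_map size_iota ltnn => h.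
  by suff: false by []; apply: h; rewrite map_inj_uniq ?iota_uniq.
by exists (t ^+ i).
Qed.

Section Generic.
Variables (k : fieldType) (l : nat).

Definition generic_pt (i : 'I_l) : ratfun k l := tofrac 'X_i.

Lemma mmap_generic p : mmap (@ratfunC k l) generic_pt p = tofrac p.
Proof.
rewrite -{2}[p]comp_mpoly_id /comp_mpoly.
rewrite (rmorph_mmap (@tofrac {mpoly k[l]}) (@mpolyC l k)).
apply: (@eq_mmap _ _ _ (@ratfunC k l) (@tofrac {mpoly k[l]} \o @mpolyC l k)) => // i.
by rewrite /= tnth_mktuple.
Qed.

Lemma generic_pow_inj (i : 'I_l) : injective (fun e : nat => generic_pt i ^+ e).
Proof.
move=> e e' /eqP; rewrite -!tofracXn tofrac_eq => /eqP.
move/(congr1 (mmap polyC (fun=> 'X))); rewrite !rmorphXn /= mmapXU.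
move/(congr1 (fun p : {poly k} => size p)).
by rewrite !size_polyXn => -[].
Qed.
End Generic.

Section Quotient.
Variable n' : nat.
Notation n := n'.+1.
Notation m := ((n + n) * n)%N.
Notation N := (n * n + 1)%N.
Variables (k : fieldType) (K : closedFieldType) (iota : {rmorphism k -> K}).

Local Notation L := (ratfun k m).
Local Notation F := (ratfun k N).
Let xi : 'I_m -> L := @generic_pt k m.
Let zeta : 'I_N -> F := @generic_pt k N.
Let d := \det (vecs xi).
Let d' := \det (covecs xi).

(** It suffices to exhibit one point where the four quantities are nonzero:
    the one with [d = 1], [d' = 0] and complementary minor 1, which is defined over
    any field. *)
Lemma generic_conditions :
  [/\ d != 0, d - d' != 0, d + d' != 0 & minor00 (pairing xi) != 0].
Proof.
have [x xE] : exists x : 'I_m -> k, sl_invariants x =1 corner_pt (first_mx n' 0) 1.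
  apply: sl_invariants_surj; rewrite ?pt_scalarK ?pt_matrixK ?oner_neq0 //.
  rewrite /minor00 (_ : row' 0 _ = 1%:M) ?det1 ?oner_neq0 //.
  by apply/matrixP => i j; rewrite !mxE (inj_eq lift_inj).
pose X (i : 'I_m) : {mpoly k[m]} := 'X_i.
have evX : meval x \o X =1 x by move=> i; apply: mevalXU.
have dE : \det (vecs x) = 1.
  rewrite -(pt_scalarK (patch (pairing x) (\det (covecs x))) (\det (vecs x))).
  exact: etrans (xE _) (pt_scalarK (first_mx n' 0) 1).
have WE : patch (pairing x) (\det (covecs x)) = first_mx n' 0.
  rewrite -[LHS](pt_matrixK _ (\det (vecs x))) -[RHS](pt_matrixK _ 1).
  by congr (vec_mx (lsubmx _)); apply/rowP => i; rewrite !mxE -xE.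
have d'E : \det (covecs x) = 0.
  by have := congr1 (fun W : 'M_n => W 0 0) WE; rewrite !mxE eqxx mulr1n /= => ->.
have minorE : minor00 (pairing x) = 1.
  rewrite -(minor00_patch _ (\det (covecs x))) WE /minor00 (_ : row' 0 _ = 1%:M) ?det1 //.
  by apply/matrixP => i j; rewrite !mxE (inj_eq lift_inj).
have nz (P : {mpoly k[m]}) : P.@[x] = 1 -> tofrac P != 0.
  move=> Px; rewrite tofrac_eq0; apply: contraTneq (oner_neq0 k) => P0.
  by rewrite -Px P0 meval0 eqxx.
have map_vecs (S : comNzRingType) (f : {rmorphism {mpoly k[m]} -> S}) :
    [/\ f (\det (vecs X)) = \det (vecs (f \o X)), f (\det (covecs X)) = \det (covecs (f \o X))
      & f (minor00 (pairing X)) = minor00 (pairing (f \o X))].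
  split; [exact: (map_side_det f false) | exact: (map_side_det f true) |].
  rewrite -map_pairing /minor00 -det_map_mx; congr (\det _).
  by apply/matrixP => i j; rewrite !mxE.
have [e1 e2 e3] := map_vecs _ (meval x).
have [t1 t2 t3] := map_vecs _ (@tofrac {mpoly k[m]}).
rewrite /pairing /vecs /covecs (eq_pt_mx evX) -/(vecs x) -/(covecs x) -/(pairing x) in e1 e2 e3.
rewrite dE in e1; rewrite d'E in e2; rewrite minorE in e3.
split.
- by rewrite /d -t1; apply: nz.
- by rewrite /d /d' -t1 -t2 -tofracB; apply: nz; rewrite mevalB e1 e2 subr0.
- by rewrite /d /d' -t1 -t2 -tofracD; apply: nz; rewrite mevalD e1 e2 addr0.
- by rewrite -t3; apply: nz.
Qed.

Variable j : {rmorphism F -> L}.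
Hypothesis jE : j =1 frac_map (@pull n' k).

Lemma j_tofrac p : j (tofrac p) = mmap (@ratfunC k m) (swap_invariants (sl_invariants xi)) p.
Proof. by rewrite jE (frac_map_tofrac (pull_inj iota)) -mmap_generic mmap_pull. Qed.

Lemma j_zeta i : j (zeta i) = swap_invariants (sl_invariants xi) i.
Proof. by rewrite j_tofrac mmapXU. Qed.

Lemma j_const c : j (ratfunC N c) = ratfunC m c.
Proof. by rewrite j_tofrac mmapC. Qed.

Let s : F := pt_matrix zeta 0 0.
Let p : F := pt_scalar zeta.

Lemma j_matrix : map_mx j (pt_matrix zeta) = patch (conj_sum (pairing xi) d d') (d + d').
Proof.
have -> : map_mx j (pt_matrix zeta) = pt_matrix (swap_invariants (sl_invariants xi)).
  by apply/matrixP => a b; rewrite !mxE j_zeta.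
by rewrite pt_matrixK pt_matrixK pt_scalarK patch00 patch_conj_sum.
Qed.

Lemma j_s : j s = d + d'.
Proof. by have := congr1 (fun W : 'M_n => W 0 0) j_matrix; rewrite mxE patch00. Qed.

Lemma j_p : j p = d * d'.
Proof.
by rewrite /p /pt_scalar j_zeta -/(pt_scalar _) pt_scalarK pt_matrixK pt_scalarK patch00.
Qed.

Lemma pairing_conj : mx_rel (conj_rel j d d') (pairing xi) (pairing xi)^T.
Proof.
have [_ c1 c2 c3] := generic_conditions.
apply: (conj_rel_entries (Z := pt_matrix zeta) j_s j_p c1 c2 (det_pairing xi) c3) => a b.
rewrite -negb_and => /negPf ab.
have := congr1 (fun W : 'M_n => W a b) j_matrix.
by rewrite mxE (patchE _ _ ab) conj_sumE.
Qed.

Lemma image_infinite : infinite_in (fun u => exists a, u = j a).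
Proof.
apply: (@infinite_in_pow _ (j (zeta (rshift (n * n) ord0)))).
  by move=> i; exists (zeta (rshift (n * n) ord0) ^+ i); rewrite rmorphXn.
move=> e e' /= ee; apply: (@generic_pow_inj k N (rshift (n * n) ord0)).
by apply: (fmorph_inj j); rewrite /= !rmorphXn.
Qed.

(** As a polynomial in [B] the expression is nonzero, since at [B = X] it is
    a power of [d^2] times [b(X, Y)]; and [j F] is infinite. *)
Lemma section_avoids_poles e (b : {mpoly k[m]}) : b != 0 -> (msize b <= e)%N ->
  exists B0 : 'M[F]_n, homeval_orbit e (@ratfunC k m) b false xi (map_mx j B0) != 0.
Proof.
move=> b0 be; have [d0 _ _ _] := generic_conditions.
pose C : {rmorphism k -> {mpoly L[n * n]}} := @mpolyC (n * n) L \o @ratfunC k m.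
pose Bg : 'M[{mpoly L[n * n]}]_n := \matrix_(i, j) 'X_(mxvec_index i j).
pose U := homeval C e b ((d%:MP) * \det Bg) (orbit_pt Bg d%:MP (map_mx (@mpolyC _ L) (pairing xi))).
have evalE y (c : L) M : (homeval C e b (c%:MP * \det Bg)
      (orbit_pt Bg c%:MP (map_mx (@mpolyC _ L) M))).@[y] =
    homeval (@ratfunC k m) e b (c * \det (\matrix_(i, j) y (mxvec_index i j)))
      (orbit_pt (\matrix_(i, j) y (mxvec_index i j)) c M).
  have BE : map_mx (meval y) Bg = \matrix_(i, j) y (mxvec_index i j).
    by apply/matrixP => i i'; rewrite !mxE /= mevalXU.
  have ME : map_mx (meval y) (map_mx (@mpolyC (n * n) L) M) = M.
    by apply/matrixP => i i'; rewrite !mxE /= mevalC.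
  rewrite (rmorph_homeval C (meval y)); apply: eq_homeval => [a||i] /=.
  - by rewrite mevalC.
  - by rewrite mevalM mevalC -BE det_map_mx.
  - by rewrite (map_orbit_pt (meval y)) BE ME /= mevalC.
have UE y : U.@[y] = homeval_orbit e (@ratfunC k m) b false xi (\matrix_(i, j) y (mxvec_index i j)).
  exact: evalE.
have U0 : U != 0.
  have : U.@[fun i => mxvec (vecs xi) 0 i] != 0.
    rewrite UE (_ : \matrix_(i, j) _ = vecs xi); last first.
      by apply/matrixP => a c; rewrite mxE mxvecE.
    rewrite /homeval_orbit (homeval_scale _ be (@orbit_pt_self _ _ xi)) mmap_generic.
    by rewrite mulf_neq0 ?expf_neq0 ?mulf_neq0 ?tofrac_eq0.
  by apply: contraNneq => ->; rewrite meval0.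
have [y yF yU] := mpoly_nonroot image_infinite U0.
have [y0 y0E] : exists y0 : 'I_(n * n) -> F, forall i, y i = j (y0 i).
  exact: (fin_all_exists yF).
exists (\matrix_(i, c) y0 (mxvec_index i c)); move: yU; rewrite UE.
by congr (homeval_orbit _ _ _ _ _ _ != 0); apply/matrixP => a c; rewrite !mxE.
Qed.

Lemma rel_orbit_pt (G : L -> L -> Prop) (B M M' : 'M[L]_n) c c' i :
  ring_relation G -> mx_rel G B B -> mx_rel G M M' -> G c c' ->
  G (orbit_pt B c M i) (orbit_pt B c' M' i).
Proof.
move=> relG GB GM Gc.
have diagG u v u' v' : G u u' -> G v v' -> mx_rel G (two_diag n' u v) (two_diag n' u' v').
  move=> Gu Gv a b; rewrite !mxE.
  case: (a == b); last exact: rel_zero.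
  by case: (a == 0).
have detG : G (\det B) (\det B) by exact: rel_det.
case/mxvec_indexP: i => a b; rewrite /orbit_pt !mxvecE !mxE; case: (split a) => a'.
  apply: rel_mulmx => //; apply: diagG; exact: rel_mul.
apply: rel_mulmx => //; apply: rel_mulmx => //; first exact: diagG.
by move=> a1 b1; rewrite ![_^T _ _]mxE; apply: (rel_adj relG GB).
Qed.

Lemma invariant_in_image (f : L) :
  invariant_ratfun iota (pairs_rep k n) f -> exists a, j a = f.
Proof.
rewrite (frac_numden f); set a := \n_(_); set b := \d_(_).
have b0 : b != 0 by exact: denom_ratioP.
move=> /(invariant_ratfunP iota (pairs_rep k n) a b0) inv.
pose e := maxn (msize a) (msize b).
have [B0 vB] := section_avoids_poles b0 (leq_maxr (msize a) (msize b)).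
set B := map_mx j B0 in vB.
have ident sw : tofrac a / tofrac b * homeval_orbit e (@ratfunC k m) b sw xi B =
    homeval_orbit e (@ratfunC k m) a sw xi B.
  have := orbit_identity (leq_maxl _ _) (leq_maxr _ _) inv (@ratfunC k m) sw xi B.
  rewrite !mmap_generic => E; apply: (@mulIf _ (tofrac b)); first by rewrite tofrac_eq0.
  by rewrite -/e in E; rewrite E mulrAC divfK ?tofrac_eq0.
have [_ c1 c2 _] := generic_conditions.
have R := conj_rel_ring j_s j_p.
(* the entries of [B] come from [F], so [B] is its own conjugate *)
have atG (q : {mpoly k[m]}) : conj_rel j d d'
    (homeval_orbit e (@ratfunC k m) q false xi B) (homeval_orbit e (@ratfunC k m) q true xi B).
  have BG : mx_rel (conj_rel j d d') B B.
    by move=> i i'; rewrite mxE; apply: conj_rel_const.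
  have dG := conj_rel_root j d d'.
  apply: rel_homeval => // [c||i].
  - by have := conj_rel_const j d d' (ratfunC N c); rewrite j_const.
  - by apply: rel_mul => //; apply: rel_det.
  - by apply: rel_orbit_pt => //; apply: pairing_conj.
have [c cE] := conj_rel_descent c1 (atG a) (atG b) (ident false) (ident true) vB.
by exists c.
Qed.

Lemma mmap_pull_act (g : SLZ2 K n) (x : 'I_m -> K) q :
  mmap iota (lin_pt (copies_mx n (double_mx g)) x) (pull q) = mmap iota x (pull q).
Proof. by rewrite !mmap_pull; apply: eq_mmapr; apply: invariants_act. Qed.

Lemma image_invariant a : invariant_ratfun iota (pairs_rep k n) (j a).
Proof.
rewrite (frac_numden a) jE (frac_map_div (pull_inj iota)) ?denom_ratioP //.
apply/invariant_ratfunP => [|g x /=].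
  by rewrite raddf_eq0 ?denom_ratioP //; apply: (pull_inj iota).
congr (_ * _); [|apply: esym]; exact: mmap_pull_act.
Qed.
End Quotient.

Theorem proposition4p1 (k : fieldType) (kbar : closedFieldType)
    (iota : {rmorphism k -> kbar})
    (kbar_closure : @is_algebraic_closure k kbar iota)
    (n : nat) (n_ge1 : (1 <= n)%N) :
  BG_stably_rational iota (SL_semidirect_Z2 k n).
Proof.
case: n n_ge1 => [//|n' _].
exists ((n'.+1 + n'.+1) * n'.+1)%N, (pairs_rep k n'.+1).
split; first exact: pairs_generically_free.
have [j jE] := frac_map_rmorphism (@pull_inj n' k kbar iota).
exists (ratfun k (n'.+1 * n'.+1 + 1)), (@ratfunC k (n'.+1 * n'.+1 + 1)).
split; last exact: ratfun_stably_rational.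
exists j => [a|f]; first exact: (j_const iota jE).
split=> [inv|[a <-]]; first exact: (invariant_in_image jE inv).
exact: (image_invariant jE).
Qed.
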